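(* Let $n=1$ and let $\psi,g$ be admissible weights. Then the following are equivalent: (a) for every volume $v>0$, the centered interval $(-R,R)$ with $|(-R,R)|_f=v$ minimizes $\mathcal{E}$ among all sets of finite perimeter $F\subset\mathbb{R}$ with $|F|_f=v$; (b) $\min_{r\ge 0}\psi(r)=\psi(0)$. Furthermore, if $\psi,g$ are strictly admissible and $\min_{r\geq 0}\psi(r)=\psi(0)$, then for every $v>0$ the centered interval of weighted volume $v$ is the unique minimizer (up to Lebesgue-null sets) of $\mathcal{E}$ among all sets of finite perimeter $F\subset\mathbb{R}$ with $|F|_f=v$.
   Context: Radial functions on $\mathbb{R}^n$ are identified with their profiles: $\psi(x)=\psi(|x|)$, $g(x)=g(|x|)$; primes denote derivatives in $r=|x|$. In dimension one, the weights are thus considered as even functions of $x$. Set $f=e^{\psi}$. A pair $\psi,g:\mathbb{R}\to[0,+\infty)$ is called admissible weights if: (1) $\psi\in C^2(\mathbb{R})$, $g\in C^1(\mathbb{R})$, and $\lim_{r\to+\infty}(\psi(r)+g(r))=+\infty$; (2) $\psi'(0)=0$; (3) $\psi''(r)+g'(r)\ge 0$ for all $r\ge 0$. They are strictly admissible if they are admissible and $\psi''(r)+g'(r)>0$ for all $r>0$. For a set of finite perimeter $F\subset\mathbb{R}^n$ with reduced boundary $\partial^*F$, $$\mathcal{E}(F)=\int_{\partial^*F} f\,d\mathcal{H}^{n-1}+\int_F g f\,dx,\qquad |F|_f=\int_F f\,dx.$$ Here $n=1$, so $\mathcal{H}^{0}$ is counting measure. *)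

(* Defs.v *)
From mathcomp Require Import all_boot all_order all_algebra.
From mathcomp Require Import all_classical all_reals all_analysis.

Set Implicit Arguments.
Unset Strict Implicit.
Unset Printing Implicit Defensive.

Import Order.TTheory GRing.Theory Num.Theory.
Import numFieldNormedType.Exports.

Local Open Scope ring_scope.
Local Open Scope classical_set_scope.

Definition C1 (R : realType) (h : R -> R) : Prop :=
  (forall x, derivable h x 1) /\ continuous (derive1 h).

Definition C2 (R : realType) (h : R -> R) : Prop :=
  (forall x, derivable h x 1) /\ C1 (derive1 h).

Definition is_min (R : realType) (A : set R) (m : R) : Prop :=
  A m /\ lbound A m.

Definition admissible (R : realType) (psi g : R -> R) : Prop :=
  [/\ (forall r : R, 0 <= psi r) /\ (forall r : R, 0 <= g r),
      [/\ C2 psi, C1 g & psi r + g r @[r --> +oo] --> +oo],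
      derive1 psi 0 = 0 &
      forall r : R, 0 <= r -> 0 <= derive1 (derive1 psi) r + derive1 g r].

Definition strictly_admissible (R : realType) (psi g : R -> R) : Prop :=
  admissible psi g /\
  forall r : R, 0 < r -> 0 < derive1 (derive1 psi) r + derive1 g r.

(* Lebesgue (Caratheodory) measurability; [measurable] on [R] would only give
   the Borel sets. *)
Definition lebesgue_measurable (R : realType) (F : set R) : Prop :=
  ((wlength (idfun : R -> R))^*)%mu.-cara.-measurable F.

Definition C1c (R : realType) (phi : R -> R) : Prop :=
  C1 phi /\ compact (closure [set x | phi x != 0]).

Definition perimeter (R : realType) (F : set R) : \bar R :=
  ereal_sup
    [set (\int[completed_lebesgue_measure]_(x in F) (derive1 phi x)%:E)%E
      | phi in [set phi : R -> R | C1c phi /\ forall x, `|phi x| <= 1]].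

Definition finite_perimeter (R : realType) (F : set R) : Prop :=
  lebesgue_measurable F /\ (perimeter F < +oo)%E.

(* [nu] is the Gauss-Green measure of [F], i.e. the distributional derivative
   of the indicator function of [F] up to sign; the integral against the signed
   measure [nu] is written with the Jordan decomposition of [nu], which does
   not depend on the Hahn decomposition [P], [N]. *)
Definition gauss_green (R : realType) (F : set R)
    (nu : {charge set (measurableTypeR R) -> \bar R})
    (P N : set (measurableTypeR R)) (nuPN : hahn_decomposition nu P N) : Prop :=
  forall phi : R -> R, C1c phi ->
    (\int[completed_lebesgue_measure]_(x in F) (derive1 phi x)%:E =
     \int[jordan_pos nuPN]_x (phi x)%:E - \int[jordan_neg nuPN]_x (phi x)%:E)%E.

(* Points of the support of the total variation |nu| of the Gauss-Green measure
   nu of F at which nu(B(x,r)) / |nu|(B(x,r)) tends to a unit vector as r -> 0+.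
   A Gauss-Green measure is unique when it exists. *)
Definition reduced_boundary (R : realType) (F : set R) : set R :=
  [set x | exists (nu : {charge set (measurableTypeR R) -> \bar R})
      (P N : set (measurableTypeR R)) (nuPN : hahn_decomposition nu P N),
    [/\ gauss_green F nuPN,
        (forall r : R, 0 < r -> (0 < charge_variation nuPN (ball x r))%E) &
        exists2 l : R, `|l| = 1 &
          fine (nu (ball x r)) / fine (charge_variation nuPN (ball x r))
            @[r --> 0^'+] --> l]].

(* A profile [h] stands for the even function [x |-> h `|x|]. *)
Definition density (R : realType) (psi : R -> R) (x : R) : R :=
  expR (psi `|x|).

Definition weighted_volume (R : realType) (psi : R -> R) (F : set R) : \bar R :=
  (\int[completed_lebesgue_measure]_(x in F) (density psi x)%:E)%E.

Definition energy (R : realType) (psi g : R -> R) (F : set R) : \bar R :=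
  (\int[@counting R R]_(x in reduced_boundary F) (density psi x)%:E +
   \int[completed_lebesgue_measure]_(x in F) (g `|x : R| * density psi x)%:E)%E.

Definition is_minimizer (R : realType) (psi g : R -> R) (v : R) (F : set R) :
    Prop :=
  [/\ finite_perimeter F,
      weighted_volume psi F = v%:E &
      forall E : set R, finite_perimeter E -> weighted_volume psi E = v%:E ->
        (energy psi g F <= energy psi g E)%E].

Definition centered_interval (R : realType) (r : R) : set R :=
  `](- r), r[%classic.

(* Main.v *)
Require Import Defs.
From mathcomp Require Import all_boot all_order all_algebra.
From mathcomp Require Import all_classical all_reals all_analysis.
From mathcomp Require Import measurable_realfun ring lra.
Import Order.TTheory GRing.Theory Num.Theory.
Import numFieldNormedType.Exports.
Set Implicit Arguments.
Unset Strict Implicit.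
Unset Printing Implicit Defensive.
Local Open Scope ring_scope.
Local Open Scope classical_set_scope.

(** Since psi' + g is nondecreasing on [0, +oo), the weight
    (psi'(|x|) + g(|x|)) f(x) admits a bathtub principle: among sets of given
    weighted volume, a centered interval minimizes its integral. The function
    K(x) = sgn(x) (f(x) - f(0)) is a primitive of psi'(|x|) f(x), and when
    f >= f(0) one has f(a) + f(b) >= 2 f(0) + K(b) - K(a) for every interval
    (a, b), with equality for centered ones; adding the two gives minimality,
    and strict monotonicity gives uniqueness. Conversely, if psi(x0) < psi(0),
    a short interval at x0 beats the centered one of the same small volume.

    These estimates apply to finite unions of intervals. A set of finite
    perimeter is one up to a null set: around each point where it is locally
    neither null nor full, Lebesgue's density theorem yields a test function
    supported there with divergence integral at least 1/2, so there are at most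
    2 P(F) such points, and the set is null or full, alternately, in between. *)

(** * Lebesgue and Borel representatives *)

(** The volume constraint enters through a Lagrange multiplier. Subtracting [forcing r] times the
    density makes the integrand change sign exactly at [|x| = r], and for sets of equal volume the
    subtracted terms cancel. The two inequalities play different roles. The perimeter estimate is
    already an equality for every interval around the origin, centered or not, so centering, and
    with it uniqueness, comes from the bathtub comparison alone. As [psi] is nonnegative, the
    density is at least 1. Hence finite weighted volume implies finite Lebesgue measure, which
    excludes half-lines in the structure result, and centered intervals attain every volume. The
    reduced boundary is given by an arbitrary charge with a Hahn decomposition. It is pinned down
    from both sides: any charge satisfying the Gauss-Green formula has no variation near a point
    that is not an endpoint, and an explicit sum of signed Dirac masses shows that every endpoint
    belongs to it. *)

Lemma integral_symdiff_null d (T : measurableType d) (R : realType)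
    (m : {measure set T -> \bar R}) (D E : set T) (h : T -> \bar R) :
  measurable D -> measurable E -> m (D `+` E) = 0%E -> measurable_fun setT h ->
  (\int[m]_(x in D) h x = \int[m]_(x in E) h x)%E.
Proof.
move=> mD mE DE0 mh.
have mDE : measurable (D `+` E) by apply: measurableU; apply: measurableD.
have ge0 (k : T -> \bar R) : (forall x, (0 <= k x)%E) -> measurable_fun setT k ->
    (\int[m]_(x in D) k x = \int[m]_(x in E) k x)%E.
  move=> k0 mk.
  rewrite (@ge0_negligible_integral _ _ _ m D (D `+` E))//; last exact: measurable_funTS.
  rewrite (@ge0_negligible_integral _ _ _ m E (D `+` E))//; last exact: measurable_funTS.
  congr (integral _ _ _); apply/seteqP; split => x [Hx nx]; split => //;
    by apply: contrapT => H; apply: nx; first [by left|by right].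
rewrite integralE [in RHS]integralE.
by rewrite !ge0//; first [exact: measurable_funepos|exact: measurable_funeneg].
Qed.

Section transfer.
Context {R : realType}.
Notation mu := (@lebesgue_measure R).
Notation cmu := (@completed_lebesgue_measure R).
Notation cR := (caratheodory_type (wlength (idfun : R -> R))^*%mu).

Lemma borel_lebesgue_measurable (G : set R) :
  measurable G -> lebesgue_measurable G.
Proof. by move=> mG; apply: sub_caratheodory. Qed.

Lemma measurable_idfun_completed :
  measurable_fun setT (idfun : cR -> measurableTypeR R).
Proof. by move=> _ B mB; rewrite setTI; exact: borel_lebesgue_measurable. Qed.

(** The Borel Lebesgue measure is the pushforward of the completed one under the identity, so this
    is a change of variables, applied to positive and negative parts. *)
Lemma integral_completed (G : set R) (h : R -> \bar R) :
  measurable G ->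
  measurable_fun setT h ->
  (\int[cmu]_(x in G) h x = \int[mu]_(x in G) h x)%E.
Proof.
move=> mG mh.
have ge0 (k : R -> \bar R) : (forall x, (0 <= k x)%E) ->
    measurable_fun setT k ->
    (\int[cmu]_(x in G) k x = \int[mu]_(x in G) k x)%E.
  move=> k0 mk.
  have mkG : measurable_fun G k by exact: measurable_funTS.
  transitivity (\int[pushforward cmu (idfun : cR -> measurableTypeR R)]_(x in G) k x)%E.
    by rewrite (ge0_integral_pushforward measurable_idfun_completed).
  refine (@eq_measure_integral _ (measurableTypeR R) R G mu
    (pushforward cmu (idfun : cR -> measurableTypeR R)) k (fun _ _ _ => erefl)).
  refine measurable_idfun_completed.
rewrite integralE [in RHS]integralE.
by rewrite !ge0//; first [exact: measurable_funepos|exact: measurable_funeneg].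
Qed.

Lemma borel_approx (F : set R) : lebesgue_measurable F ->
  exists G B : set R, [/\ measurable G,
    measurable B, mu B = 0%E, G `<=` F & F `<=` G `|` B].
Proof.
rewrite /lebesgue_measurable -completed_caratheodory_measurable.
rewrite g_sigma_completed_algebra_genE => -[G mG [N [B [mB B0 NB]] <-]].
by exists G, B; split=> //; exact: setUS.
Qed.

Lemma borel_representative (F : set R) : lebesgue_measurable F ->
  exists2 G : set R, measurable G & cmu (F `+` G) = 0%E.
Proof.
move=> mF; have [G [B [mG mB B0 GF FGB]]] := borel_approx mF.
have mB' := borel_lebesgue_measurable mB.
have mG' := borel_lebesgue_measurable mG.
exists G => //; apply/eqP; rewrite eq_le measure_ge0 andbT -B0.
apply: (@le_measure _ _ _ cmu).
- by apply: mem_set; apply: measurableU; apply: measurableD.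
- exact: mem_set.
- by move=> x [[Fx nGx]|[Gx nFx]]; [case: (FGB x Fx)|case: nFx; exact: GF].
Qed.

Lemma measurable_completed (h : R -> \bar R) : measurable_fun setT h ->
  measurable_fun setT (h : cR -> \bar R).
Proof. by move=> mh; apply: (measurableT_comp mh measurable_idfun_completed). Qed.

End transfer.

(** * Integration over finite unions of intervals *)

Section calculus.
Context {R : realType}.
Notation mu := (@lebesgue_measure R).

Lemma integrable_itv (h : R -> R) (a b : R) : continuous h ->
  mu.-integrable `[a, b] (EFin \o h).
Proof.
move=> ch; apply: continuous_compact_integrable; first exact: segment_compact.
exact: continuous_subspaceT.
Qed.

Lemma FTC_oo (h H : R -> R) (a b : R) : a <= b -> continuous h ->
  (forall x : R, a <= x <= b -> is_derive x 1 H (h x)) ->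
  (\int[mu]_(x in `]a, b[) (h x)%:E = (H b - H a)%:E)%E.
Proof.
rewrite le_eqVlt => /predU1P[<- _ _|ab ch dH].
  by rewrite set_itvoo0// integral_set0 subrr.
have cH x : a <= x <= b -> {for x, continuous H}.
  by move=> /dH Hx; apply: differentiable_continuous; exact/derivable1_diffP.
rewrite -(@integral_itv_bndoo _ a b _ true false); last first.
  by apply/measurable_EFinP; apply: measurable_funTS; exact: continuous_measurable_fun.
rewrite EFinB; apply: continuous_FTC2 => //.
- exact: continuous_subspaceT.
- split.
  + move=> x; rewrite in_itv/= => /andP[ax xb].
    by have [] := dH x; first by rewrite !ltW.
  + by apply: cvg_at_right_filter; apply: cH; rewrite lexx ltW.
  + by apply: cvg_at_left_filter; apply: cH; rewrite lexx ltW.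
- move=> x; rewrite in_itv/= => /andP[ax xb].
  rewrite derive1E; have := dH x; rewrite !ltW// => /(_ isT) ?.
  exact: derive_val.
Qed.

(** Integration starts at [- M], so the primitive is only claimed in a bounded window; users choose
    [M] with some margin around the points that they evaluate. *)
Lemma primitive_exists (h : R -> R) (M : R) : continuous h ->
  exists H : R -> R, forall x : R, `|x| < M -> is_derive x 1 H (h x).
Proof.
move=> ch; exists (fun x => \int[mu]_(t in `[- M, x]) h t) => x.
rewrite ltr_norml => /andP[Mx xM].
have [] := @continuous_FTC1_closed R h (- M) x M xM _ Mx _.
- exact: integrable_itv.
- exact: ch.
- by move=> dF <-; rewrite derive1E; exact: derivableP.
Qed.

(* [L] encodes pairwise disjoint intervals with no common endpoint as soon as
   [ends L] is strictly sorted. *)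
Definition ends (L : seq (R * R)) : seq R := flatten [seq [:: p.1; p.2] | p <- L].

Definition union_itv (L : seq (R * R)) : set R :=
  foldr (fun p (X : set R) => `]p.1, p.2[ `|` X) set0 L.

Lemma measurable_union_itv L : measurable (union_itv L).
Proof. by elim: L => [|p L IH] //=; apply: measurableU. Qed.

Lemma union_itv_gt L x y : path <%R x (ends L) -> union_itv L y -> x < y.
Proof.
elim: L x => [//|[a b] L IH] x /= /and3P[xa ab pL] [|].
  by rewrite in_itv/= => /andP[ay _]; exact: lt_trans ay.
by move=> /(IH _ pL); apply: lt_trans; exact: lt_trans ab.
Qed.

Lemma union_itv_bounded L : exists M : R, union_itv L `<=` `[- M, M].
Proof.
elim: L => [|[a b] L [M LM]]; first by exists 0.
exists (Num.max M (Num.max `|a| `|b|)) => x [|/LM] /=; rewrite !in_itv/=.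
  move=> /andP[ax xb]; rewrite lerNl !le_max; apply/andP; split.
    apply/orP; right; apply/orP; left; rewrite -normrN.
    by rewrite (le_trans _ (ler_norm _))// lerN2 ltW.
  by apply/orP; right; apply/orP; right; rewrite (le_trans (ltW xb))// ler_norm.
by move=> /andP[Mx xM]; rewrite lerNl !le_max xM lerNl Mx.
Qed.

Lemma integrable_union_itv (h : R -> R) L : continuous h ->
  mu.-integrable (union_itv L) (EFin \o h).
Proof.
move=> ch; have [M LM] := union_itv_bounded L.
refine (@integrableS _ _ _ mu `[- M, M]%classic (union_itv L) _ _ _ LM _) => //; first exact: measurable_union_itv.
exact: integrable_itv.
Qed.

Lemma integral_union_itv (h H : R -> R) L : sorted <%R (ends L) ->
  continuous h ->
  (forall p (x : R), p \in L -> p.1 <= x <= p.2 -> is_derive x 1 H (h x)) ->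
  (\int[mu]_(x in union_itv L) (h x)%:E = (\sum_(p <- L) (H p.2 - H p.1))%:E)%E.
Proof.
move=> + ch; elim: L => [|[a b] L IH] /= sL dH.
  by rewrite integral_set0 big_nil.
move: sL => /andP[ab pL].
rewrite integral_setU//=; first last.
- apply/disj_setPS => x [/=]; rewrite in_itv/= => /andP[_ xb].
  by move=> /(union_itv_gt pL) bx; move: (lt_trans xb bx); rewrite ltxx.
- apply/measurable_EFinP; apply: measurable_funTS; exact: continuous_measurable_fun.
- exact: measurable_union_itv.
have dL p (x : R) : p \in L -> p.1 <= x <= p.2 -> is_derive x 1 H (h x).
  by move=> pL' px; apply: (dH p) => //; rewrite inE pL' orbT.
have dab (x : R) : a <= x <= b -> is_derive x 1 H (h x).
  by apply: (dH (a, b)); rewrite mem_head.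
by rewrite (IH (path_sorted pL) dL) (FTC_oo (ltW ab) ch dab) big_cons EFinD.
Qed.

End calculus.

(** * Smooth step functions *)

Section step.
Context {R : realType}.

(** Asking for the bound at every [h] lets the squared positive part be differentiated at its kink
    and elsewhere by one polynomial estimate. *)
Lemma is_derive_quadratic (F : R -> R) (x d : R) (C : R) :
  (forall h, `|F (h + x) - F x - d * h| <= C * h ^+ 2) -> is_derive x 1 F d.
Proof.
move=> FC; suff H : h^-1 *: ((F \o shift x) (h *: (1 : R)) - F x) @[h --> 0^'] --> d.
  by split; [apply/cvg_ex; exists d|apply: cvg_lim].
have C0 : 0 <= C by have := le_trans (normr_ge0 _) (FC 1); rewrite expr1n mulr1.
apply/cvgrPdist_le => e e0; near=> h.
have h0 : h != 0 by near: h; exact: nbhs_dnbhs_neq.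
rewrite /= distrC [_ *: 1]mulr1 -(ler_pM2l (_ : 0 < `|h|)) ?normr_gt0//.
rewrite -normrM mulrBr mulrA divff// mul1r (mulrC h d) (le_trans (FC h))//.
rewrite -(real_normK (num_real h)) expr2 mulrA mulrC ler_wpM2l//.
(* The added 1 keeps the denominator positive when [C] is 0. *)
have : `|h| <= e / (C + 1).
  near: h; apply: dnbhs0_le; rewrite divr_gt0//; lra.
rewrite ler_pdivlMr; [|lra]; have := normr_ge0 h; nra.
Unshelve. all: by end_near. Qed.

(** The truncated power that generates quadratic splines: it is C^1, with derivative twice the
    positive part. *)
Definition sqpos (t : R) : R := (Num.max t 0) ^+ 2.

Lemma is_derive_sqpos (c x : R) :
  is_derive x 1 (fun t => sqpos (t - c)) (2 * Num.max (x - c) 0).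
Proof.
apply: (@is_derive_quadratic _ _ _ 1) => h; rewrite /sqpos ler_norml.
by case: (leP (x - c) 0) => x0; case: (leP (h + x - c) 0) => hx0;
  apply/andP; split; nra.
Qed.

(* A quadratic spline: its derivative [dstep a b] is the tent of height
   [2 / (b - a)] on [[a, b]], so that it is C^1. *)
Definition step (a b t : R) : R :=
  2 / (b - a) ^+ 2 *
  (sqpos (t - a) - 2 * sqpos (t - (a + b) / 2) + sqpos (t - b)).

Definition dstep (a b t : R) : R :=
  4 / (b - a) ^+ 2 *
  (Num.max (t - a) 0 - 2 * Num.max (t - (a + b) / 2) 0 + Num.max (t - b) 0).

Lemma is_derive_step (a b x : R) : is_derive x 1 (step a b) (dstep a b x).
Proof.
have -> : step a b = (2 / (b - a) ^+ 2) *: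
    ((fun t => sqpos (t - a)) - 2 *: (fun t => sqpos (t - (a + b) / 2)) +
     (fun t => sqpos (t - b))).
  by apply/funext.
have := is_derive_sqpos; move=> D.
have Da := D a x; have Db := D b x; have Dm := D ((a + b) / 2) x.
apply: is_derive_eq; rewrite /dstep /GRing.scale/=; ring.
Qed.

Lemma step_le a b t : a < b -> t <= a -> step a b t = 0.
Proof.
move=> ab ta; rewrite /step /sqpos !max_r; [ring|lra|lra|lra].
Qed.

Lemma step_ge a b t : a < b -> b <= t -> step a b t = 1.
Proof.
move=> ab bt; rewrite /step /sqpos !max_l; [|lra|lra|lra].
by field; apply/eqP; lra.
Qed.

Lemma dstep_itv a b t : a < b -> 0 <= dstep a b t <= 2 / (b - a).
Proof.
move=> ab; rewrite /dstep.
(* The tent peaks at the midpoint, where the bracket equals [(b - a) / 2]. *)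
have -> : 2 / (b - a) = 4 / (b - a) ^+ 2 * ((b - a) / 2).
  by field; apply/eqP; lra.
have c0 : 0 < 4 / (b - a) ^+ 2 by rewrite divr_gt0// exprn_gt0// subr_gt0.
rewrite pmulr_rge0// ler_pM2l//.
by case: (leP (t - a)) => ?; case: (leP (t - (a + b) / 2)) => ?;
  case: (leP (t - b)) => ?; apply/andP; split; lra.
Qed.

Lemma dstep_out a b t : a < b -> t <= a \/ b <= t -> dstep a b t = 0.
Proof.
move=> ab [ta|bt]; rewrite /dstep.
  by rewrite !max_r; [ring|lra|lra|lra].
by rewrite !max_l; [field; apply/eqP|..]; lra.
Qed.

Lemma step_itv a b t : a < b -> 0 <= step a b t <= 1.
Proof.
move=> ab; rewrite /step.
rewrite [X in _ && (_ <= X)](_ : 1 = 2 / (b - a) ^+ 2 * ((b - a) ^+ 2 / 2)); last first.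
  by field; apply/eqP; lra.
have c0 : 0 < 2 / (b - a) ^+ 2 by rewrite divr_gt0// exprn_gt0// subr_gt0.
rewrite pmulr_rge0// ler_pM2l// /sqpos.
by case: (leP (t - a)) => ?; case: (leP (t - (a + b) / 2)) => ?;
  case: (leP (t - b)) => ?; apply/andP; split; nra.
Qed.

End step.

Section test_functions.
Context {R : realType}.
Notation mu := (@lebesgue_measure R).

Lemma continuous_dstep (a b : R) : continuous (dstep a b).
Proof.
have cp c : continuous (fun t : R => Num.max (t - c) 0).
  move=> x; apply: (@continuous_max _ _ (fun t => t - c) (cst 0)).
    by apply: cvgB; [exact: cvg_id|exact: cvg_cst].
  exact: cvg_cst.
move=> x; rewrite /dstep; apply: cvgM; first exact: cvg_cst.
apply: cvgD; last exact: cp.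
by apply: cvgB; [exact: cp|apply: cvgM; [exact: cvg_cst|exact: cp]].
Qed.

Lemma is_derive_step2 (a b c d x : R) :
  is_derive x 1 (step a b - step c d) (dstep a b x - dstep c d x).
Proof.
have := is_derive_step a b x; have := is_derive_step c d x => ? ?.
exact: is_deriveB.
Qed.

Lemma derive1_step2 (a b c d : R) :
  derive1 (step a b - step c d) = (fun x => dstep a b x - dstep c d x).
Proof.
by apply/funext => x; rewrite derive1E; have ? := is_derive_step2 a b c d x;
  exact: derive_val.
Qed.

Lemma compact_support (phi : R -> R) (a b : R) :
  (forall x, phi x != 0 -> a <= x <= b) -> compact (closure [set x | phi x != 0]).
Proof.
move=> phiab; apply: (@subclosed_compact _ _ `[a, b]%classic).
- exact: closed_closure.
- exact: segment_compact.
- rewrite [X in _ `<=` X](closure_id _).1; last exact: itv_closed.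
  by apply: closureS => x /phiab; rewrite /= in_itv.
Qed.

(** Each step is 0 far to the left and 1 far to the right, so the difference of two steps vanishes
    at both ends. This is why all test functions below are such differences. *)
Lemma C1c_step2 (a b c d : R) : a < b -> c < d -> C1c (step a b - step c d).
Proof.
move=> ab cd; split; first split.
- by move=> x; have [] := is_derive_step2 a b c d x.
- rewrite derive1_step2 => x; apply: cvgB; exact: continuous_dstep.
- apply: (@compact_support _ (Num.min a c) (Num.max b d)) => x.
  apply: contraNT; rewrite !fctE negb_and -!ltNge lt_min gt_max.
  move=> /orP[/andP[xa xc]|/andP[bx dx]].
    by rewrite !step_le ?subrr// ltW.
  by rewrite !step_ge ?subrr// ltW.
Qed.

Lemma step2_le1 (a b c d x : R) : a < b -> c < d ->
  `|(step a b - step c d) x| <= 1.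
Proof.
move=> ab cd; rewrite !fctE ler_norml.
have := step_itv x ab; have := step_itv x cd; lra.
Qed.

End test_functions.

(** * Finite sums of Dirac masses, as measures and as charges *)

Section dirac_sums.
Context {R : realType}.
Notation delta x := (@dirac _ (measurableTypeR R) x R).

Lemma dirac_sum_measure (s : seq R) :
  exists m : {measure set (measurableTypeR R) -> \bar R},
    (forall A, m A = (\sum_(x <- s) \1_A x)%:E) /\
    forall phi : R -> R, measurable_fun setT phi ->
      m.-integrable setT (EFin \o phi) /\
      (\int[m]_x (phi x)%:E = (\sum_(x <- s) phi x)%:E)%E.
Proof.
elim: s => [|x s [m [mE mint]]].
  exists mzero; split=> [A|phi mphi]; first by rewrite big_nil.
  split; last by rewrite integral_measure_zero big_nil.
  apply/integrableP; split; first exact/measurable_EFinP.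
  by rewrite integral_measure_zero.
exists (measure_add (delta x) m); split=> [A|phi mphi].
  by rewrite /= /msum !big_ord_recl big_ord0 addr0 /= mE big_cons EFinD.
have [im Em] := mint phi mphi.
have mphi' : measurable_fun setT (EFin \o phi) by exact/measurable_EFinP.
have id : (delta x).-integrable setT (EFin \o phi).
  apply/integrableP; split => //.
  rewrite integral_dirac//; last first.
    by apply: (measurableT_comp (@abse_measurable _ setT)).
  by rewrite diracT mul1e ltry.
split; last first.
  rewrite integral_measure_add// Em integral_dirac//= diracT mul1e.
  by rewrite big_cons EFinD.
apply/integrableP; split => //.
rewrite ge0_integral_measure_add//; last exact: measurableT_comp.
by apply: lte_add_pinfty; [case/integrableP: id|case/integrableP: im].
Qed.

(** The candidate Gauss-Green charge of a union of intervals: the integral of a derivative over an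
    interval gives mass 1 to the right endpoint and -1 to the left one. *)
Lemma dirac_sum_charge (s t : seq R) :
  exists nu : {charge set (measurableTypeR R) -> \bar R},
    forall A, nu A = (\sum_(x <- s) \1_A x - \sum_(x <- t) \1_A x)%:E.
Proof.
elim: s => [|x s [nu nuE]]; last first.
  exists (cadd (charge_of_finite_measure (delta x)) nu) => A.
  transitivity ((\1_A x)%:E + nu A)%E; first by [].
  by rewrite nuE big_cons -addrA EFinD.
elim: t => [|x t [nu nuE]].
  by exists czero => A; rewrite !big_nil subrr.
exists (cadd (copp (charge_of_finite_measure (delta x))) nu) => A.
transitivity (- (\1_A x)%:E + nu A)%E; first by [].
by rewrite nuE !big_cons big_nil -EFinN -EFinD; congr EFin; ring.
Qed.

End dirac_sums.

(** * The reduced boundary *)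

Section jordan.
Context d (T : measurableType d) (R : realType).
Variables (nu : {charge set T -> \bar R}) (P N : set T).
Variable nuPN : hahn_decomposition nu P N.

Lemma jordan_posI A : measurable A -> jordan_pos nuPN A = nu (A `&` P).
Proof. by move=> mA; rewrite jordan_posE cjordan_posE /crestr0 mem_set. Qed.

Lemma jordan_negI A : measurable A -> jordan_neg nuPN A = (- nu (A `&` N))%E.
Proof. by move=> mA; rewrite jordan_negE cjordan_negE /crestr0 mem_set. Qed.

(* Both parts of the Jordan decomposition are carried by disjoint sets, so they
   vanish where they agree. *)
Lemma charge_variation0 (U : set T) : measurable U ->
  (forall A, measurable A -> jordan_pos nuPN (A `&` U) = jordan_neg nuPN (A `&` U)) ->
  charge_variation nuPN U = 0%E.
Proof.
have [[mP _] [mN _] _ PN0] := nuPN => mU eqU.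
have E := eqU P mP.
have pU : jordan_pos nuPN U = 0%E.
  rewrite jordan_posI// setIC -[RHS]oppe0 -(charge0 nu) -[in RHS](set0I U) -PN0.
  rewrite -setIA (setIC N) setIA -jordan_negI; last exact: measurableI.
  rewrite -E jordan_posI; last exact: measurableI.
  by rewrite setIAC setIid.
have := eqU setT measurableT; rewrite setTI /charge_variation/= pU => <-.
by rewrite adde0.
Qed.

End jordan.

Section reduced_boundary_finite.
Context {R : realType}.

Lemma notin_dist (s : seq R) (x : R) : x \notin s ->
  exists2 d : R, 0 < d & forall t, t \in s -> d <= `|x - t|.
Proof.
elim: s => [|y s IH]; first by exists 1.
rewrite inE negb_or => /andP[xy /IH[d d0 ds]].
exists (Num.min d `|x - y|); first by rewrite lt_min d0 normr_gt0 subr_eq0.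
by move=> t; rewrite inE ge_min => /predU1P[->|/ds ->//]; rewrite lexx orbT.
Qed.

(** A plateau inside []c, d[] with ramps of width [e]; the factor 1/2 keeps the two ramps from
    overlapping even for [n = 0]. *)
Definition bump (c d : R) (n : nat) : R -> R :=
  let e := (d - c) / 2 / n.+1%:R in step c (c + e) - step (d - e) d.

Lemma bump_width (c d : R) (n : nat) : c < d ->
  0 < (d - c) / 2 / n.+1%:R <= (d - c) / 2.
Proof.
move=> cd; have cd0 : 0 < (d - c) / 2 by lra.
rewrite divr_gt0//= ler_pdivrMr// ler_peMr//; first exact: ltW.
by rewrite ler1n.
Qed.

Lemma bump_out c d n x : c < d -> ~~ (c < x < d) -> bump c d n x = 0.
Proof.
move=> cd; have := bump_width n cd; rewrite /bump.
set e := _ / _ / _ => /andP[e0 ecd]; rewrite negb_and -!leNgt !fctE.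
case/orP => H; first by rewrite !step_le ?subrr//; lra.
by rewrite !step_ge ?subrr//; lra.
Qed.

(** At an interior point the ramps eventually lie on either side of [x], and the value is then
    exactly 1. *)
Lemma bump_cvg c d x : c < d -> bump c d n x @[n --> \oo] --> (\1_`]c, d[ x : R).
Proof.
move=> cd; have [cxd|cxd] := boolP (c < x < d); last first.
  rewrite indicE memNset; last by rewrite /= in_itv/=; exact/negP.
  rewrite (_ : (fun n => _) = cst 0); first exact: cvg_cst.
  by apply/funext => n; rewrite bump_out.
rewrite indicE mem_set; last by rewrite /= in_itv.
move/andP: cxd => [cx xd].
apply: cvg_near_cst.
have m0 : 0 < Num.min (x - c) (d - x) by rewrite lt_min; apply/andP; split; lra.
have e0 : 0 < Num.min (x - c) (d - x) / ((d - c) / 2) by rewrite divr_gt0//; lra.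
near=> n.
have : (d - c) / 2 / n.+1%:R < Num.min (x - c) (d - x).
  rewrite mulrC -ltr_pdivlMr; last by lra.
  by near: n; apply: (near_infty_natSinv_lt (PosNum e0)).
have := bump_width n cd; rewrite /bump.
set e := (d - c) / 2 / _ => /andP[e_gt0 ecd]; rewrite lt_min => /andP[exc exd].
rewrite !fctE step_ge ?step_le ?subr0//; lra.
Unshelve. all: by end_near. Qed.

Lemma C1c_bump c d n : c < d -> C1c (bump c d n).
Proof.
move=> cd; have /andP[e0 _] := bump_width n cd.
by apply: C1c_step2; [rewrite ltrDl|rewrite gtrBl].
Qed.

Lemma bump_le1 c d n x : c < d -> `|bump c d n x| <= 1.
Proof.
move=> cd; have /andP[e0 _] := bump_width n cd.
by apply: step2_le1; [rewrite ltrDl|rewrite gtrBl].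
Qed.

Lemma measurable_bump c d n : measurable_fun setT (bump c d n).
Proof.
apply: continuous_measurable_fun => x.
apply: differentiable_continuous; apply/derivable1_diffP.
have [] := is_derive_step2 c (c + (d - c) / 2 / n.+1%:R)
  (d - (d - c) / 2 / n.+1%:R) d x.
by [].
Qed.

Variable m : {finite_measure set (measurableTypeR R) -> \bar R}.

Lemma integrable_bump c d n : c < d -> m.-integrable setT (EFin \o bump c d n).
Proof.
move=> cd; apply: (@le_integrable _ _ _ m _ measurableT _ (cst 1%E)).
- by apply/measurable_EFinP; exact: measurable_bump.
- by move=> x _ /=; rewrite normr1 lee_fin; exact: bump_le1.
- by apply: finite_measure_integrable_cst.
Qed.

(** Recovers the measure of an open interval from integrals of admissible test functions, by
    dominated convergence with the constant 1, integrable since [m] is finite. *)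
Lemma integral_bump_cvg c d : c < d ->
  (\int[m]_x (bump c d n x)%:E)%E @[n --> \oo] --> m `]c, d[%classic.
Proof.
move=> cd.
have mI : measurable_fun setT (fun x : measurableTypeR R => (\1_`]c, d[ x)%:E : \bar R).
  by apply/measurable_EFinP; exact: measurable_indic.
have -> : m `]c, d[%classic = (\int[m]_x (\1_`]c, d[ x)%:E)%E.
  by rewrite integral_indic// setIT.
have [||||_ _] := @dominated_convergence _ _ _ m _ measurableT
  (fun n x => (bump c d n x)%:E) (fun x => (\1_`]c, d[ x)%:E) (cst 1%E)
  (fun n => (measurable_EFinP _ _).2 (measurable_bump c d n)).
- exact: mI.
- by apply: aeW => x _; apply: cvg_EFin; [exact: nearW|exact: bump_cvg].
- exact: finite_measure_integrable_cst.
- by apply: aeW => x n _; rewrite lee_fin; exact: bump_le1.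
- exact.
Qed.

Lemma integral_bump_fin c d n : c < d ->
  (\int[m]_x (bump c d n x)%:E)%E \is a fin_num.
Proof. by move=> cd; apply: integrable_fin_num => //; exact: integrable_bump. Qed.

End reduced_boundary_finite.

Section uniqueness.
Context {R : realType}.
Variables m1 m2 : {finite_measure set (measurableTypeR R) -> \bar R}.

(** Open rays form a generating class stable under intersection, and a ray meets the ball in an open
    interval or not at all. Uniqueness of measures then applies to the restrictions to the ball. *)
Lemma eq_measure_oo (x r : R) :
  (forall c d, x - r <= c -> d <= x + r -> c < d ->
     m1 `]c, d[%classic = m2 `]c, d[%classic) ->
  forall A, measurable A -> m1 (A `&` ball x r) = m2 (A `&` ball x r).
Proof.
move=> eqcd A mA.
have mB : @measurable _ (measurableTypeR R) (ball x r) by exact: measurable_ball.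
change (mrestr m1 mB A = mrestr m2 mB A).
apply: (@measure_unique _ R (measurableTypeR R) (@RGenOInfty.G R)
  (fun n => `](- n%:R), +oo[%classic) _ _ _ _ _ _ _ _ _ mA).
- exact: RGenOInfty.measurableE.
- move=> _ _ [a ->] [b ->]; exists (Num.max a b).
  by apply/seteqP; split => y /=; rewrite !in_itv/= !andbT gt_max => /andP.
- by move=> n; exists (- n%:R).
- apply/seteqP; split=> // y _; exists (Num.truncn `|y|).+1 => //=.
  by rewrite in_itv/= andbT ltrNl (le_lt_trans (ler_norm _))// normrN truncnS_gt.
- move=> _ [a ->].
  change (m1 (`]a, +oo[%classic `&` ball x r) = m2 (`]a, +oo[%classic `&` ball x r)).
  rewrite ball_itv.
  rewrite (_ : _ `&` _ = `]Num.max a (x - r), x + r[%classic); last first.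
    apply/seteqP; split => y /=; rewrite !in_itv/= andbT gt_max.
      by move=> [-> /andP[-> ->]].
    by move=> /andP[/andP[-> ->] ->].
  have [lt|ge] := ltP (Num.max a (x - r)) (x + r).
    by apply: eqcd => //; rewrite le_max lexx orbT.
  by rewrite set_itv_ge ?measure0// bnd_simp -leNgt.
- move=> k; change (m1 (`](- k%:R)%R, +oo[%classic `&` ball x r) < +oo)%E.
  rewrite ltey_eq fin_num_measure//.
  by apply: measurableI.
Qed.

End uniqueness.

Section reduced_boundary_support.
Context {R : realType}.
Variables (F : set R) (bs as_ : seq R).
Hypothesis gaussF : forall phi : R -> R, C1c phi ->
  (\int[completed_lebesgue_measure]_(x in F) (derive1 phi x)%:E =
   (\sum_(b <- bs) phi b - \sum_(a <- as_) phi a)%:E)%E.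

(** Take any charge that witnesses membership and a ball around [x] free of jumps. Bumps in the ball
    see no jump, so the two Jordan parts agree on its open subintervals, hence on its Borel subsets.
    Being mutually singular they vanish there, against the support condition. *)
Lemma reduced_boundary_sub (x : R) :
  reduced_boundary F x -> x \in bs ++ as_.
Proof.
move=> [nu [P [N [nuPN [gg supp _]]]]]; apply/negPn/negP => /notin_dist[r r0 rs].
suff : charge_variation nuPN (ball x r) = 0%E.
  by move=> E; move: (supp r r0); rewrite E ltxx.
apply: charge_variation0; first exact: measurable_ball.
apply: eq_measure_oo => c d xc dx cd.
have dist t : t \in bs ++ as_ -> ~~ (c < t < d).
  move=> /rs rt; apply/negP => /andP[ct td].
  by move: rt; rewrite leNgt ltr_norml; lra.
have eqb n : (\int[jordan_pos nuPN]_x (bump c d n x)%:E =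
              \int[jordan_neg nuPN]_x (bump c d n x)%:E)%E.
  have := gg _ (C1c_bump n cd); rewrite gaussF; last exact: C1c_bump.
  rewrite big1_seq; last first.
    by move=> t /andP[_ tb]; rewrite bump_out// dist// mem_cat tb.
  rewrite big1_seq; last first.
    by move=> t /andP[_ tb]; rewrite bump_out// dist// mem_cat tb orbT.
  rewrite subrr => /esym/eqP; rewrite sube_eq ?add0e; first by move=> /eqP.
    exact: integral_bump_fin.
  by rewrite fin_num_adde_defl// integral_bump_fin.
have := @integral_bump_cvg _ (jordan_neg nuPN) _ _ cd.
under eq_fun do rewrite -eqb.
have := @integral_bump_cvg _ (jordan_pos nuPN) _ _ cd.
exact: cvg_unique.
Qed.

End reduced_boundary_support.

Section reduced_boundary_jumps.
Context {R : realType}.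
Variables (F : set R) (bs as_ : seq R).
Hypothesis gaussF : forall phi : R -> R, C1c phi ->
  (\int[completed_lebesgue_measure]_(x in F) (derive1 phi x)%:E =
   (\sum_(b <- bs) phi b - \sum_(a <- as_) phi a)%:E)%E.
Hypothesis uniq_jumps : uniq (bs ++ as_).

Lemma sum_indic_uniq (s : seq R) (x : R) (A : set R) : uniq s -> x \in s -> A x ->
  (forall t, t \in s -> A t -> t = x) -> \sum_(t <- s) (\1_A t : R) = 1.
Proof.
move=> us xs Ax sA; rewrite (bigD1_seq x)//= indicE mem_set//.
rewrite big1_seq ?addr0// => t /andP[tx ts]; rewrite indicE memNset// => At.
by move: tx; rewrite (sA t)// eqxx.
Qed.

Lemma sum_indic0 (s : seq R) (A : set R) :
  (forall t, t \in s -> ~ A t) -> \sum_(t <- s) (\1_A t : R) = 0.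
Proof.
by move=> sA; rewrite big1_seq// => t /andP[_ /sA nAt]; rewrite indicE memNset.
Qed.

(** The witness is the Dirac charge with the right ends as positive Hahn set. As no point is
    repeated, nothing cancels and each jump has variation 1; in a ball that isolates [x] the
    quotient is constantly 1 at a right end and -1 at a left end. *)
Lemma reduced_boundary_jumps (x : R) : x \in bs ++ as_ -> reduced_boundary F x.
Proof.
move=> xs.
have disj t : t \in as_ -> t \notin bs.
  by move=> ta; move: uniq_jumps; rewrite cat_uniq => /and3P[_ /hasPn/(_ t ta)].
have [ub ua] : uniq bs /\ uniq as_.
  by move: uniq_jumps; rewrite cat_uniq => /and3P[].
have [nu nuE] := dirac_sum_charge bs as_.
pose P : set (measurableTypeR R) := [set` bs].
have mP : measurable P.
  apply: countable_measurable; first by move=> t; exact: measurable_set1.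
  exact/finite_set_countable/finite_seq.
have nuPN : hahn_decomposition nu P (~` P).
  split; last 2 first.
  - exact: setUCr.
  - exact: setICr.
  - split=> // A mA AP; rewrite nuE lee_fin [X in _ - X]sum_indic0 ?subr0.
      by apply: sumr_ge0 => t _; rewrite indicE.
    by move=> t /disj/negP tb /AP.
  - split=> [|A mA AP]; first exact: measurableC.
    rewrite nuE lee_fin [X in X - _]sum_indic0 ?sub0r ?oppr_le0.
      by apply: sumr_ge0 => t _; rewrite indicE.
    by move=> t tb /AP.
have posE A : measurable A -> jordan_pos nuPN A = (\sum_(t <- bs) \1_A t)%:E.
  move=> mA; rewrite jordan_posI// nuE [X in _ - X]sum_indic0 ?subr0; last first.
    by move=> t /disj/negP tb [].
  congr EFin; apply: eq_big_seq => t tb; rewrite !indicE in_setI.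
  by rewrite [t \in P]mem_set// andbT.
have negE A : measurable A -> jordan_neg nuPN A = (\sum_(t <- as_) \1_A t)%:E.
  move=> mA; rewrite jordan_negI// nuE [X in X - _]sum_indic0 ?sub0r; last first.
    by move=> t tb [].
  rewrite EFinN oppeK.
  congr EFin; apply: eq_big_seq => t /disj/negP tb; rewrite !indicE in_setI.
  by rewrite [t \in ~` P]mem_set// andbT.
have gg : gauss_green F nuPN.
  move=> phi cphi; rewrite gaussF//.
  have mphi : measurable_fun setT phi.
    apply: continuous_measurable_fun => t.
    by apply: differentiable_continuous; apply/derivable1_diffP; case: cphi => -[].
  have [m1 [m1E m1int]] := dirac_sum_measure bs.
  have [m2 [m2E m2int]] := dirac_sum_measure as_.
  rewrite (@eq_measure_integral _ _ _ _ m1); last by move=> A mA _; rewrite m1E; exact: posE.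
  rewrite (@eq_measure_integral _ _ _ _ m2 (jordan_neg nuPN)); last first.
    by move=> A mA _; rewrite m2E; exact: negE.
  by rewrite (m1int _ mphi).2 (m2int _ mphi).2.
have [r0 r0_gt0 iso] : exists2 r0 : R, 0 < r0 &
    forall r t, r <= r0 -> t \in bs ++ as_ -> ball x r t -> t = x.
  (* By uniqueness [x] is absent from the list with one occurrence of [x] removed, so it keeps a
     positive distance from the other jumps. *)
  have [|r0 r0_gt0 far] := @notin_dist _ (rem x (bs ++ as_)) x.
    by rewrite mem_rem_uniqF.
  exists r0 => // r t rr0 tb; rewrite -ball_normE/= => xt.
  apply/eqP; apply: contraLR xt => tx; rewrite -leNgt (le_trans rr0)//.
  by apply: far; rewrite mem_rem_uniq// inE tx.
have mB r : @measurable _ (measurableTypeR R) (ball x r) by exact: measurable_ball.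
have varE r : charge_variation nuPN (ball x r) = (\sum_(t <- bs ++ as_) \1_(ball x r) t)%:E.
  by rewrite big_cat EFinD -posE// -negE.
have var1 r : 0 < r -> r <= r0 -> charge_variation nuPN (ball x r) = 1%E.
  move=> r_gt0 rr0; rewrite varE (@sum_indic_uniq _ x)//; first exact: ballxx.
  by move=> t; exact: iso.
exists nu, P, (~` P), nuPN; split=> //.
  (* The variation is computed only for radii up to [r0]; larger balls follow by monotonicity. *)
  move=> r r_gt0; apply: (@lt_le_trans _ _ (charge_variation nuPN (ball x (Num.min r r0)))).
    by rewrite var1 ?lte_fin// ?lt_min ?r_gt0// ge_min lexx orbT.
  by apply: le_measure; rewrite ?inE//; apply: le_ball; rewrite ge_min lexx.
move: xs; rewrite mem_cat => /orP[xb|xa].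
- exists 1; first by rewrite normr1.
  apply: cvg_near_cst; near=> r.
  have r_gt0 : 0 < r by [].
  have rr0 : r <= r0 by near: r; exact: nbhs_right_le.
  rewrite var1// nuE (@sum_indic_uniq _ x)//; last first.
    + by move=> t tb; apply: iso rr0 _; rewrite mem_cat tb.
    + exact: ballxx.
  rewrite sum_indic0 ?subr0 ?divr1//.
  move=> t ta /(iso r t rr0); rewrite mem_cat ta orbT => /(_ isT) tx.
  by move: (disj t ta); rewrite tx xb.
- exists (-1); first by rewrite normrN1.
  apply: cvg_near_cst; near=> r.
  have r_gt0 : 0 < r by [].
  have rr0 : r <= r0 by near: r; exact: nbhs_right_le.
  rewrite var1// nuE [X in _ - X](@sum_indic_uniq _ x)//; last first.
    + by move=> t tb; apply: iso rr0 _; rewrite mem_cat tb orbT.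
    + exact: ballxx.
  rewrite sum_indic0 ?sub0r ?divr1//.
  move=> t tb /(iso r t rr0); rewrite mem_cat tb => /(_ isT) tx.
  by move: (disj x xa); rewrite -tx tb.
Unshelve. all: by end_near. Qed.

Lemma reduced_boundaryE : reduced_boundary F = [set` bs ++ as_].
Proof.
apply/seteqP; split => x; last exact: reduced_boundary_jumps.
exact: reduced_boundary_sub.
Qed.

End reduced_boundary_jumps.

(** * Sets of finite perimeter are finite unions of intervals *)

Section alternating_intervals.
Context {R : realType}.
Variables A B : set R.
Hypotheses (oA : open A) (oB : open B) (AB0 : A `&` B = set0).

(** Connectedness: the trace of [A] on [I] is open, and also closed because it is the trace of the
    complement of [B]. *)
Lemma interval_dichotomy (I : set R) : is_interval I -> I `<=` A `|` B ->
  I `<=` A \/ I `<=` B.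
Proof.
move=> /connected_intervalP cI IAB.
have [IA0|IA0] := pselect (I `&` A = set0).
  by right => x Ix; case: (IAB x Ix) => // Ax; suff : set0 x by []; rewrite -IA0.
left; suff <- : I `&` A = I by move=> x [].
apply: cI; first exact/set0P/eqP.
- by exists A.
- exists (~` B); first exact: open_closedC.
  apply/seteqP; split => x [Ix] H; split => //.
    by move=> Bx; suff : set0 x by []; rewrite -AB0.
  by case: (IAB x Ix).
Qed.

Lemma path_gap (t : R) (s : seq R) : path <%R t s ->
  exists2 e : R, 0 < e & forall u, u \in s -> t + e <= u.
Proof.
move=> ts; have /allP tlt := order_path_min lt_trans ts.
have [|e e0 es] := @notin_dist _ s t.
  by apply/negP => /tlt; rewrite ltxx.
exists e => // u us; have := es u us; have := tlt u us => tu.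
by rewrite distrC gtr0_norm ?subr_gt0//; lra.
Qed.

(** The invariant is that the stretch just after [c] lies in [B]. The gap after the first point [t]
    must then lie in [A], and the gap after the next point [u] in [B], since no point of [s] has the
    same set on both sides. So [(t, u)] is emitted and the argument restarts from [u]; as two points
    are consumed at a time, the induction is on a bound for the size. *)
Lemma alternating_intervals_from (n : nat) (s : seq R) (c : R) :
  (size s <= n)%N -> path <%R c s ->
  (forall x, c < x -> [\/ A x, B x | x \in s]) ->
  (forall x, x \in s -> ~ A x) ->
  (forall x, c < x -> (forall t, t \in s -> x < t) -> B x) ->
  (forall t e, t \in s -> 0 < e -> ~ (forall x, 0 < `|x - t| < e -> B x)) ->
  (forall t e, t \in s -> 0 < e -> ~ (forall x, 0 < `|x - t| < e -> A x)) ->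
  (forall t, ~ (forall x, t < x -> A x)) ->
  exists2 L, path <%R c (ends L) & forall x, c < x -> (A x <-> union_itv L x).
Proof.
move=> + + + + + + + Aunb; elim: n s c => [|n IH] s c.
  rewrite leqn0 size_eq0 => /eqP-> _ _ _ cB _ _.
  exists [::] => // x cx; split => // Ax.
  by suff : set0 x by []; rewrite -AB0; split => //; exact: cB.
case: s => [|t s] sn; first by apply: IH.
rewrite [path _ _ _]/= => /andP[ct ts] cov sA cB nB nA.
have /allP tlt := order_path_min lt_trans ts.
have leftB x : c < x -> x < t -> B x.
  move=> cx xt; apply: cB => // u; rewrite inE => /predU1P[->//|/tlt].
  exact: lt_trans.
have tn : t \notin s by apply/negP => /tlt; rewrite ltxx.
pose gap (u : R) (s' : seq R) := [set x | u < x /\ forall v, v \in s' -> x < v].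
have gapI u s' : is_interval (gap u s').
  move=> x y [ux xs] [uy ys] z /andP[xz zy]; split.
    exact: lt_le_trans xz.
  by move=> v vs; apply: le_lt_trans zy _; exact: ys.
have gapA : gap t s `<=` A.
  have [|//|gB] := @interval_dichotomy (gap t s) (gapI t s).
    move=> x [tx xs]; have [] := cov x (lt_trans ct tx); [by left|by right|].
    rewrite inE => /predU1P[xt|/xs]; last by rewrite ltxx.
    by move: tx; rewrite xt ltxx.
  have [e e0 es] := path_gap ts.
  (* This radius keeps the punctured neighbourhood between [c] and the next point of [s], where both
     sides would lie in [B]. *)
  exfalso; apply: (nB t (Num.min e (t - c))); first by rewrite mem_head.
    by rewrite lt_min e0 subr_gt0.
  move=> x; rewrite lt_min normr_gt0 subr_eq0 => /and3P[xt xe xc].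
  move: xe xc; rewrite !ltr_norml => /andP[_ xe] /andP[xc _].
  case: (ltgtP x t) xt => // xt _; first by apply: leftB => //; lra.
  by apply: gB; split => // u /es; apply: lt_le_trans; lra.
case: s ts sn cov sA cB nB nA tlt tn gapA => [|u s] ts sn cov sA cB nB nA tlt tn gapA.
  (* With an odd number of points, [A] would contain the half-line beyond the last one. *)
  by exfalso; apply: (Aunb t) => x tx; apply: gapA.
move: ts => /= /andP[tu us].
have /allP ult := order_path_min lt_trans us.
have tuA x : t < x -> x < u -> A x.
  move=> tx xu; apply: gapA; split => // v; rewrite inE => /predU1P[->//|/ult].
  exact: lt_trans.
have cu := lt_trans ct tu.
have gapB : gap u s `<=` B.
  have [|gA|//] := @interval_dichotomy (gap u s) (gapI u s).
    move=> x [ux xs]; have [] := cov x (lt_trans cu ux); [by left|by right|].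
    rewrite !inE => /or3P[/eqP xt|/eqP xu|/xs]; last by rewrite ltxx.
      by move: (lt_trans tu ux); rewrite xt ltxx.
    by move: ux; rewrite xu ltxx.
  have [e e0 es] := path_gap us.
  exfalso; apply: (nA u (Num.min e (u - t))); first by rewrite inE mem_head orbT.
    by rewrite lt_min e0 subr_gt0.
  move=> x; rewrite lt_min normr_gt0 subr_eq0 => /and3P[xt xe xc].
  move: xe xc; rewrite !ltr_norml => /andP[_ xe] /andP[xc _].
  case: (ltgtP x u) xt => // xt _; first by apply: tuA => //; lra.
  by apply: gA; split => // v /es; apply: lt_le_trans; lra.
have sub v : v \in s -> v \in t :: u :: s by move=> vs; rewrite !inE vs !orbT.
have [|||||||L uL AL] := IH s u.
- by rewrite -ltnS ltnW.
- exact: us.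
- move=> x ux; have [] := cov x (lt_trans cu ux); [by constructor 1|by constructor 2|].
  rewrite !inE => /or3P[/eqP xt|/eqP xu|xs]; last by constructor 3.
    by move: (lt_trans tu ux); rewrite xt ltxx.
  by move: ux; rewrite xu ltxx.
- by move=> x /sub; apply: sA.
- by move=> x ux xs; apply: gapB.
- by move=> v e /sub; apply: nB.
- by move=> v e /sub; apply: nA.
exists ((t, u) :: L); first by rewrite /= ct tu.
move=> x cx /=; rewrite in_itv/=; case: (ltgtP x u) => xu.
- split; last first.
    by move=> [/andP[tx _]|/(union_itv_gt uL)]; [exact: tuA|rewrite ltNge ltW].
  move=> Ax; left; rewrite andbT ltNge le_eqVlt; apply/negP => /predU1P[xt|xt].
    by apply: (sA x) => //; rewrite xt mem_head.
  by suff : set0 x by []; rewrite -AB0; split => //; exact: leftB.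
- rewrite andbF; split; first by move=> /(AL x xu); right.
  by move=> [//|/(AL x xu)].
- rewrite andbF xu; split.
    by move=> /sA; rewrite inE mem_head orbT => /(_ isT).
  by move=> [//|/(union_itv_gt uL)]; rewrite ltxx.
Qed.

Lemma alternating_intervals (s : seq R) : sorted <%R s ->
  (forall x, [\/ A x, B x | x \in s]) ->
  (forall x, x \in s -> ~ A x) ->
  (forall t e, t \in s -> 0 < e -> ~ (forall x, 0 < `|x - t| < e -> B x)) ->
  (forall t e, t \in s -> 0 < e -> ~ (forall x, 0 < `|x - t| < e -> A x)) ->
  (forall t, ~ (forall x, t < x -> A x)) ->
  (forall t, ~ (forall x, x < t -> A x)) ->
  exists2 L, sorted <%R (ends L) & A = union_itv L.
Proof.
move=> ss cov sA nB nA Aunbr Aunbl.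
(* Any number to the left of all of [s] serves; for empty [s] the default makes it -1. Up to the
   first point of [s] the line lies in [B], since [A] contains no left half-line. *)
pose c := head 0 s - 1.
have cs : path <%R c s.
  by move: ss; rewrite /c; case: s {cov sA nB nA c} => //= t s ->; rewrite andbT gtrBl.
have /allP clt := order_path_min lt_trans cs.
pose gap := [set x | forall v, v \in s -> x < v].
have gapI : is_interval gap.
  by move=> x y xs ys z /andP[xz zy] v vs; apply: le_lt_trans zy _; exact: ys.
have gapB : gap `<=` B.
  have [|gA|//] := @interval_dichotomy gap gapI.
    move=> x xs; have [] := cov x; [by left|by right|].
    by move=> /xs; rewrite ltxx.
  exfalso; apply: (Aunbl c) => x xc; apply: gA => v /clt; exact: lt_trans.
have [||||||L cL AL] := @alternating_intervals_from (size s) s c (leqnn _) cs.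
- by move=> x _; exact: cov.
- exact: sA.
- by move=> x _; exact: gapB.
- exact: nB.
- exact: nA.
- exact: Aunbr.
exists L; first exact: path_sorted cL.
apply/seteqP; split => x; have [cx|xc] := ltP c x; first by move/AL => /(_ cx).
- move=> Ax; suff : set0 x by [].
  rewrite -AB0; split => //; apply: gapB => v /clt; exact: le_lt_trans.
- by move=> /AL; exact.
- by move=> /(union_itv_gt cL); rewrite ltNge xc.
Qed.

End alternating_intervals.

(** * Consequences of Lebesgue's density theorem *)

Section density.
Context {R : realType}.
Notation mu := (@lebesgue_measure R).
Implicit Types E G U : set R.

(** The density theorem with the quotient cleared, a ball of radius [r] having measure [2 r]; this
    avoids division in the extended reals. *)
Lemma lebesgue_density_fin E : measurable E ->
  {ae mu, forall x, forall e : R, 0 < e -> \forall r \near 0^'+,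
    (mu (E `&` ball x r) < (((\1_E x : R) + e) * (r *+ 2))%:E)%E /\
    ((((\1_E x : R) - e) * (r *+ 2))%:E < mu (E `&` ball x r))%E}.
Proof.
move=> mE; have := lebesgue_density mE.
apply: (@filterS _ _ (ae_filter_ringOfSetsType mu)) => x xP e e0.
have Pl := xP _ (open_nbhs_nbhs (conj (open_ereal_lt_ereal (x := ((\1_E x : R) + e)%:E)) _)).
have Pg := xP _ (open_nbhs_nbhs (conj (open_ereal_gt_ereal (x := ((\1_E x : R) - e)%:E)) _)).
near=> r.
have r0 : 0 < r by [].
have r2 : 0 < r *+ 2 by rewrite pmulrn_lgt0.
have : (mu (E `&` ball x r) / mu (ball x r) < ((\1_E x : R) + e)%:E)%E.
  near: r; apply: Pl; rewrite /= lte_fin ltrDl//.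
have : (((\1_E x : R) - e)%:E < mu (E `&` ball x r) / mu (ball x r))%E.
  near: r; apply: Pg; rewrite /= lte_fin gtrBl//.
rewrite lebesgue_measure_ball ?ltW// inver gt_eqF//.
rewrite lte_pdivlMr// lte_pdivrMr// -!EFinM => ? ?.
Unshelve. all: by end_near. Qed.

(** A point of [E] around which [E] is null violates the density theorem, so the whole intersection
    lies in the exceptional null set. *)
Lemma locally_null_null E U : measurable E ->
  (forall x, U x -> exists2 d : R, 0 < d & mu (E `&` ball x d) = 0%E) ->
  mu.-negligible (E `&` U).
Proof.
move=> mE Unull; apply: negligibleS (lebesgue_density_fin mE) => x [Ex Ux] /= xP.
have [d d0 Ed0] := Unull x Ux.
have near_false : \forall r \near (0 : R)^'+, False.
  near=> r.
  have r0 : 0 < r by [].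
  have : mu (E `&` ball x r) = 0%E.
    apply/eqP; rewrite eq_le measure_ge0 andbT -Ed0 le_measure ?inE//.
    + by apply: measurableI => //; exact: measurable_ball.
    + by apply: measurableI => //; exact: measurable_ball.
    + apply: setIS; apply: le_ball; near: r; exact: nbhs_right_le.
  have [_] : (mu (E `&` ball x r) < (((\1_E x : R) + 1 / 2) * (r *+ 2))%:E)%E /\
    ((((\1_E x : R) - 1 / 2) * (r *+ 2))%:E < mu (E `&` ball x r))%E.
    (* At tolerance 1/2 the lower density bound is [r], which is positive, while the ball meets [E]
       in a null set. *)
    by near: r; apply: xP; lra.
  rewrite indicE mem_set// => + E0; rewrite E0 lte_fin -(mulr_natr r 2) mulr1n; nra.
by have [] := @filter_ex _ (0 : R)^'+ _ _ near_false.
Unshelve. all: by end_near. Qed.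

(** A non-negligible set contains a density point. The theorem is applied to the complement of [E],
    whose density there is 0, to bound the missing part directly. *)
Lemma density_ball E U (e : R) : measurable E -> open U ->
  ~ mu.-negligible (E `&` U) -> 0 < e ->
  exists y r : R, [/\ 0 < r, ball y r `<=` U &
    (mu (ball y r `\` E) <= (e * (r *+ 2))%:E)%E].
Proof.
move=> mE oU EU e0.
have mCE : measurable (~` E) by exact: measurableC.
have [y [Ey Uy] yP] : exists2 y, (E `&` U) y & forall e : R, 0 < e ->
  \forall r \near 0^'+,
    (mu (~` E `&` ball y r) < (((\1_(~` E) y : R) + e) * (r *+ 2))%:E)%E /\
    ((((\1_(~` E) y : R) - e) * (r *+ 2))%:E < mu (~` E `&` ball y r))%E.
  apply: contrapT => noy; apply: EU.
  apply: negligibleS (lebesgue_density_fin mCE) => y Ey yP; apply: noy.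
  by exists y.
have := yP e e0; rewrite indicE memNset//= add0r => yPe.
have [r [r0 rU rE]] : exists r : R, [/\ 0 < r, ball y r `<=` U &
    (mu (~` E `&` ball y r) < (e * (r *+ 2))%:E)%E].
  have /(@filter_ex _ (0 : R)^'+) : \forall r \near (0 : R)^'+, [/\ 0 < r, ball y r `<=` U &
    (mu (~` E `&` ball y r) < (e * (r *+ 2))%:E)%E].
    have /nbhs_ballP[d /= d0 dU] := open_nbhs_nbhs (conj oU Uy).
    near=> r; split => //.
    - apply: subset_trans dU; apply: le_ball; near: r; exact: nbhs_right_le.
    - by near: r; apply: filterS yPe => r [].
  by case=> r; exists r.
by exists y, r; split=> //; rewrite setDE setIC ltW.
Unshelve. all: by end_near. Qed.

End density.

Section step_integrals.
Context {R : realType}.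
Notation mu := (@lebesgue_measure R).
Implicit Types E : set R.

Lemma measurable_dstep (a b : R) D : measurable_fun D (dstep a b).
Proof.
by apply: measurable_funTS; apply: continuous_measurable_fun; exact: continuous_dstep.
Qed.

Lemma integral_dstep_restrict E (a b : R) : measurable E -> a < b ->
  (\int[mu]_(x in E) (dstep a b x)%:E =
   \int[mu]_(x in E `&` `]a, b[) (dstep a b x)%:E)%E.
Proof.
move=> mE ab; rewrite -{1}(setUIDK E `]a, b[%classic).
have d0 x : (0 <= (dstep a b x)%:E)%E by rewrite lee_fin; case/andP: (dstep_itv x ab).
rewrite ge0_integral_setU//; last 4 first.
- by apply: measurableI.
- by apply: measurableD.
- by apply/measurable_EFinP; exact: measurable_dstep.
- by apply/disj_setPS => x [[_ ?] [_ ?]].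
rewrite [X in (_ + X)%E]integral0_eq ?adde0// => x [_ /=].
rewrite in_itv/= => /negP; rewrite negb_and -!leNgt => /orP xab.
by rewrite dstep_out.
Qed.

Lemma integral_dstep_le E (a b : R) : measurable E -> a < b ->
  (\int[mu]_(x in E) (dstep a b x)%:E <= (2 / (b - a))%:E * mu (E `&` `]a, b[))%E.
Proof.
move=> mE ab; rewrite integral_dstep_restrict//.
have mEI : measurable (E `&` `]a, b[) by apply: measurableI.
rewrite -integral_cst//; apply: ge0_le_integral => //.
- by move=> x _; rewrite lee_fin; case/andP: (dstep_itv x ab).
- by apply/measurable_EFinP; exact: measurable_dstep.
- by move=> x _; rewrite lee_fin; case/andP: (dstep_itv x ab).
Qed.

(** The tent has total integral 1, and what [E] misses is at most the height [2 / (b - a)] times the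
    missing length. *)
Lemma integral_dstep_ge E (a b : R) : measurable E -> a < b ->
  (1 - (2 / (b - a))%:E * mu (`]a, b[ `\` E) <= \int[mu]_(x in E) (dstep a b x)%:E)%E.
Proof.
move=> mE ab.
have mCE : measurable (~` E) by exact: measurableC.
have d0 x : (0 <= (dstep a b x)%:E)%E by rewrite lee_fin; case/andP: (dstep_itv x ab).
have tot : (1 = \int[mu]_(x in E) (dstep a b x)%:E +
                \int[mu]_(x in ~` E) (dstep a b x)%:E)%E.
  rewrite -ge0_integral_setU//; last 2 first.
  - by apply/measurable_EFinP; exact: measurable_dstep.
  - by apply/disj_setPS => x [].
  rewrite setUCr integral_dstep_restrict// setTI.
  rewrite (FTC_oo (ltW ab) (@continuous_dstep _ a b) (fun x _ => is_derive_step a b x)).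
  by rewrite (step_ge ab (lexx b)) (step_le ab (lexx a)) subr0.
rewrite leeBlDr; last first.
  rewrite fin_numM//.
  rewrite ge0_fin_numE// (@le_lt_trans _ _ (mu `]a, b[))//.
    by rewrite le_measure// ?inE//; apply: measurableD.
  by rewrite lebesgue_measure_itv/= lte_fin ab -EFinB ltry.
rewrite {1}tot; apply: leeD => //.
by apply: le_trans (integral_dstep_le mCE ab) _; rewrite setDE setIC.
Qed.

Lemma C1c_add (f g : R -> R) : C1c f -> C1c g ->
  C1c (f + g) /\ derive1 (f + g) = derive1 f + derive1 g.
Proof.
move=> [[df cf] kf] [[dg cg] kg].
have dfg : derive1 (f + g) = derive1 f + derive1 g.
  by apply/funext => x; rewrite !fctE !derive1E deriveD.
split; last exact: dfg.
split; first split.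
- by move=> x; apply: derivableD.
- by rewrite dfg => x; apply: cvgD; [exact: cf|exact: cg].
- apply: (subclosed_compact _ (compactU kf kg)); first exact: closed_closure.
  rewrite -closureU; apply: closureS => x /=; rewrite !fctE => fg.
  have [f0|] := eqVneq (f x) 0; last by left.
  by right; move: fg; rewrite f0 add0r.
Qed.

End step_integrals.

Lemma itv_oo_sub {R : realType} (a b c d : R) : a < b -> `]a, b[ `<=` `]c, d[ ->
  c <= a /\ b <= d.
Proof.
move=> ab sub; split; rewrite leNgt; apply/negP => H.
- have [bc|cb] := leP b c.
    by have := sub ((a + b) / 2); rewrite /= !in_itv/= => /(_ _); lra.
  by have := sub ((a + c) / 2); rewrite /= !in_itv/= => /(_ _); lra.
- have [ad|da] := leP d a.
    by have := sub ((a + b) / 2); rewrite /= !in_itv/= => /(_ _); lra.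
  by have := sub ((d + b) / 2); rewrite /= !in_itv/= => /(_ _); lra.
Qed.

(** * Jump points and the test functions that detect them *)

Section jump_points.
Context {R : realType}.
Notation mu := (@lebesgue_measure R).
Variable G : set R.
Hypotheses (mG : measurable G) (finG : (mu G < +oo)%E).

(** The boundary of [G] modulo null sets: unlike the topological boundary, it does not change when
    [G] is modified on a null set. *)
Definition jump_set : set R := [set x | forall d : R, 0 < d ->
  mu (G `&` ball x d) <> 0%E /\ mu (~` G `&` ball x d) <> 0%E].

Lemma integrable_dstep2 (a b c d : R) : a < b -> c < d ->
  mu.-integrable G (EFin \o derive1 (step a b - step c d)).
Proof.
move=> ab cd; rewrite derive1_step2.
apply: measurable_bounded_integrable => //.
- by apply: measurable_funB; exact: measurable_dstep.
- exists (2 / (b - a) + 2 / (d - c)); split; first exact: num_real.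
  move=> M ltM x _ /=; apply: ltW; apply: le_lt_trans ltM.
  rewrite ler_norml; have := dstep_itv x ab; have := dstep_itv x cd; lra.
Qed.

(** Near [x] there is a ball nearly filled by [G] and another nearly free of it. Stepping up across
    the first and down across the second yields at least 3/4 - 1/4 over [G], in whichever order the
    balls lie. *)
Lemma jump_test (x d : R) : jump_set x -> 0 < d ->
  exists phi : R -> R, [/\ C1c phi, forall y, `|phi y| <= 1,
    forall y, d <= `|x - y| -> phi y = 0,
    mu.-integrable G (EFin \o derive1 phi) &
    ((1 / 2)%:E <= \int[mu]_(y in G) (derive1 phi y)%:E)%E].
Proof.
move=> Gx d0; have [G1 G0] := Gx d d0.
have nn E : measurable E -> mu (E `&` ball x d) <> 0%E -> ~ mu.-negligible (E `&` ball x d).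
  move=> mE E0 /negligibleP E1; apply: E0; apply: E1.
  by apply: measurableI => //; exact: measurable_ball.
(* On a ball of radius [r] the tent has height [1 / r], so a fraction 1/8 of the length [2 r] costs
   1/4. *)
have e0 : 0 < (1 / 8 : R) by lra.
have mCG : measurable (~` G) by exact: measurableC.
have oB : open (ball x d) by exact: ball_open.
have [y [r [r0 ry Hy]]] := density_ball mG oB (nn _ mG G1) e0.
have [z [t [t0 tz Hz]]] := density_ball mCG oB (nn _ mCG G0) e0.
have ab : y - r < y + r by lra.
have cd : z - t < z + t by lra.
exists (step (y - r) (y + r) - step (z - t) (z + t)); split.
- exact: C1c_step2.
- by move=> u; exact: step2_le1.
(* Both balls lie within distance [d] of [x], so farther away the two steps are both 0 or both 1. *)
- move=> u du; rewrite !fctE.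
  move: ry tz; rewrite !ball_itv => /(itv_oo_sub ab)[xy yx] /(itv_oo_sub cd)[xz zx].
  have [xu|ux] := leP x u.
    rewrite distrC ger0_norm ?subr_ge0// in du.
    by rewrite !step_ge ?subrr//; lra.
  rewrite gtr0_norm ?subr_gt0// in du.
  by rewrite !step_le ?subrr//; lra.
- exact: integrable_dstep2.
- rewrite derive1_step2.
  have iJ a b : a < b -> mu.-integrable G (fun u => (dstep a b u)%:E).
    move=> a_b; apply: measurable_bounded_integrable => //.
      exact: measurable_dstep.
    exists (2 / (b - a)); split; first exact: num_real.
    move=> M ltM u _ /=; apply: ltW; apply: le_lt_trans ltM.
    by rewrite ler_norml; have := dstep_itv u a_b; lra.
  rewrite (@integralB_EFin _ _ _ mu G
    (dstep (y - r) (y + r)) (dstep (z - t) (z + t)) mG (iJ _ _ ab) (iJ _ _ cd)).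
  apply: (@le_trans _ _ ((3 / 4)%:E - (1 / 4)%:E)%E).
    by rewrite -EFinB lee_fin; lra.
  apply: leeB.
    apply: le_trans (integral_dstep_ge mG ab); rewrite -ball_itv.
    apply: (@le_trans _ _ (1 - (2 / (y + r - (y - r)))%:E * (1 / 8 * (r *+ 2))%:E)%E).
      rewrite -EFinM -EFinB lee_fin -(mulr_natr r 2).
      by rewrite le_eqVlt; apply/orP; left; apply/eqP; field; apply/eqP; lra.
    by apply: leeB => //; apply: lee_wpmul2l => //; rewrite lee_fin divr_ge0//; lra.
  apply: le_trans (integral_dstep_le mG cd) _; rewrite -ball_itv.
  rewrite setDE setCK setIC in Hz.
  apply: (@le_trans _ _ ((2 / (z + t - (z - t)))%:E * (1 / 8 * (t *+ 2))%:E)%E).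
    by apply: lee_wpmul2l => //; rewrite lee_fin divr_ge0//; lra.
  rewrite -EFinM lee_fin -(mulr_natr t 2).
  by rewrite le_eqVlt; apply/orP; left; apply/eqP; field; apply/eqP; lra.
Qed.

End jump_points.

Section structure.
Context {R : realType}.
Notation mu := (@lebesgue_measure R).
Variable G : set R.
Hypotheses (mG : measurable G) (finG : (mu G < +oo)%E).

(* The supports of the single tests are shrunk to be disjoint, which keeps the
   sum bounded by 1. *)
Lemma jump_tests (s : seq R) (d : R) : uniq s -> (forall x, x \in s -> jump_set G x) ->
  0 < d ->
  exists phi : R -> R, [/\ C1c phi, forall y, `|phi y| <= 1,
    forall y, (forall x, x \in s -> d <= `|x - y|) -> phi y = 0,
    mu.-integrable G (EFin \o derive1 phi) &
    (((size s)%:R / 2)%:E <= \int[mu]_(y in G) (derive1 phi y)%:E)%E].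
Proof.
move=> + + d0; elim: s d d0 => [|x s IH] d d0 /=.
  move=> _ _; exists (step 0 1 - step 0 1); split.
  - by apply: C1c_step2.
  - by move=> y; apply: step2_le1.
  - by move=> y _; rewrite !fctE subrr.
  - by apply: integrable_dstep2.
  - rewrite derive1_step2 mul0r.
    by under eq_integral do rewrite subrr; rewrite integral0.
move=> /andP[xs us] sG.
have [e e0 es] := notin_dist xs.
(* [e] separates [x] from the remaining points, so by the triangle inequality supports of radius
   [e / 2] cannot meet. *)
have d'0 : 0 < Num.min d (e / 2) by rewrite lt_min d0 divr_gt0.
have [phi [cphi phi1 phi0 iphi Iphi]] :=
  IH _ d'0 us (fun y ys => sG y (@mem_behead _ (x :: s) _ ys)).
have [psi [cpsi psi1 psi0 ipsi Ipsi]] := jump_test mG finG (sG x (mem_head _ _)) d'0.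
have [cs ds] := C1c_add cpsi cphi.
have disj y : psi y = 0 \/ phi y = 0.
  have [/psi0|xy] := leP (Num.min d (e / 2)) `|x - y|; [by left|right].
  apply: phi0 => t ts; rewrite ge_min; apply/orP; right.
  move: xy; rewrite lt_min => /andP[_ xy]; have := es t ts.
  by have := ler_distD y x t; rewrite (distrC y t); lra.
exists (psi + phi); split.
- exact: cs.
- by move=> y; rewrite !fctE; have [->|->] := disj y; rewrite ?add0r ?addr0.
- move=> y yd; rewrite !fctE psi0 ?phi0 ?addr0//.
  + by move=> t ts; rewrite ge_min yd// inE ts orbT.
  + by rewrite ge_min yd// mem_head.
- rewrite ds; move: (@integrableD _ (measurableTypeR R) R mu G mG _ _ ipsi iphi).
  exact: eq_integrable.
- rewrite ds; have := @integralD_EFin _ (measurableTypeR R) R mu G mG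
    (derive1 psi) (derive1 phi) ipsi iphi.
  rewrite /= => ->.
  apply: le_trans (leeD Ipsi Iphi); rewrite -EFinD lee_fin -natr1; lra.
Qed.

Lemma finite_jump_set (M : R) :
  (forall phi : R -> R, C1c phi -> (forall x, `|phi x| <= 1) ->
    (\int[mu]_(x in G) (derive1 phi x)%:E <= M%:E)%E) ->
  finite_set (jump_set G).
Proof.
(* An infinite jump set would contain more than [2 M] points, and their combined test would exceed
   [M]. *)
move=> bnd; apply: contrapT => /(@infinite_set_fset _ _ (Num.truncn (2 * M)).+1)[B BS Bn].
have [phi [cphi phi1 _ _ I]] :=
  @jump_tests (finmap.enum_fset B) 1 (finmap.fset_uniq B) (fun x xB => BS x xB) ltr01.
have := le_trans I (bnd phi cphi phi1); rewrite lee_fin => H.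
have : (Num.truncn (2 * M)).+1%:R <= (size (finmap.enum_fset B))%:R :> R by rewrite ler_nat.
by have := truncnS_gt (2 * M); lra.
Qed.

Definition locally_full : set R :=
  [set x | exists2 d : R, 0 < d & mu (~` G `&` ball x d) = 0%E].
Definition locally_null : set R :=
  [set x | exists2 d : R, 0 < d & mu (G `&` ball x d) = 0%E].

Lemma null_subset (E E' : set R) : measurable E -> measurable E' ->
  E `<=` E' -> mu E' = 0%E -> mu E = 0%E.
Proof.
move=> mE mE' sub E0; apply/eqP; rewrite eq_le measure_ge0 andbT -E0.
by apply: le_measure => //; exact: mem_set.
Qed.

Lemma open_locally_null E : measurable E ->
  open [set x : R | exists2 d : R, 0 < d & mu (E `&` ball x d) = 0%E].
Proof.
move=> mE; rewrite openE => x [d d0 Ed]; apply/nbhs_ballP; exists d => //= y xy.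
have [e e0 sub] : exists2 e : R, 0 < e & ball y e `<=` ball x d.
  have : nbhs y (ball x d) by apply: open_nbhs_nbhs; split => //; exact: ball_open.
  by move=> /nbhs_ballP[e /= e0 eB]; exists e.
exists e => //; apply: null_subset Ed => //; last exact: setIS.
  by apply: measurableI => //; exact: measurable_ball.
by apply: measurableI => //; exact: measurable_ball.
Qed.

Lemma finite_perimeter_union_itv (M : R) :
  (forall phi : R -> R, C1c phi -> (forall x, `|phi x| <= 1) ->
    (\int[mu]_(x in G) (derive1 phi x)%:E <= M%:E)%E) ->
  exists2 L, sorted <%R (ends L) & mu (G `+` union_itv L) = 0%E.
Proof.
move=> /finite_jump_set fS.
have mCG : measurable (~` G) by exact: measurableC.
have oA : open locally_full by exact: open_locally_null.
have oB : open locally_null by exact: open_locally_null.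
have mA := open_measurable oA; have mB := open_measurable oB.
have mBall (x r : R) : @measurable _ (measurableTypeR R) (ball x r) by exact: measurable_ball.
(* A common point would have a ball covered by two null sets. *)
have AB0 : locally_full `&` locally_null = set0.
  apply/seteqP; split => // x [[d d0 dG] [e e0 eG]].
  have m0 : 0 < Num.min d e by rewrite lt_min d0.
  have : (mu (ball x (Num.min d e)) <= mu (~` G `&` ball x d) + mu (G `&` ball x e))%E.
    apply: le_trans (measureU2 _ _ _); [|by apply: measurableI..].
    apply: le_measure; [exact: mem_set| |].
      by apply: mem_set; apply: measurableU; apply: measurableI.
    move=> y yb; have [Gy|nGy] := pselect (G y); [right|left]; split => //;
      by apply: le_ball yb; rewrite ge_min lexx ?orbT.
  rewrite dG eG adde0; apply/negP; rewrite -ltNge.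
  by rewrite lebesgue_measure_ball ?ltW// lte_fin pmulrn_lgt0.
have nA : mu (~` G `&` locally_full) = 0%E.
  by apply/negligibleP; [by apply: measurableI|exact: locally_null_null].
have nB : mu (G `&` locally_null) = 0%E.
  by apply/negligibleP; [by apply: measurableI|exact: locally_null_null].
(* Up to a null set [locally_full] is contained in [G]; its finite measure is what excludes
   half-lines. *)
have Afin : (mu locally_full < +oo)%E.
  rewrite (@le_lt_trans _ _ (mu G + mu (~` G `&` locally_full))%E) ?nA ?adde0//.
  rewrite -(adde0 (mu G)) -nA; apply: le_trans (measureU2 _ _ _) => //; last by apply: measurableI.
  apply: le_measure; [exact: mem_set| |].
    by apply: mem_set; apply: measurableU => //; apply: measurableI.
  by move=> y Ay; have [Gy|nGy] := pselect (G y); [left|right].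
have /finite_fsetP[X SX] := fS.
pose s := sort <=%R (finmap.enum_fset X).
have sP x : x \in s <-> jump_set G x by rewrite mem_sort SX.
have ss : sorted <%R s by rewrite sort_lt_sorted finmap.fset_uniq.
have jumpP x : jump_set G x <-> ~ locally_full x /\ ~ locally_null x.
  split=> [Sx|[nAx nBx] d d0].
    by split => -[d /Sx[]].
  by split => E; [apply: nBx|apply: nAx]; exists d.
(* A single point is null, so if a punctured neighbourhood of [t] is locally null for [E], then so
   is [t]. Hence a jump point cannot have the same type on both sides. *)
have punct (E : set R) (t e : R) : measurable E -> 0 < e ->
    mu.-negligible (E `&` [set x : R | exists2 d : R, 0 < d & mu (E `&` ball x d) = 0%E]) ->
    (forall x : R, 0 < `|x - t| < e -> exists2 d : R, 0 < d & mu (E `&` ball x d) = 0%E) ->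
    exists2 d : R, 0 < d & mu (E `&` ball t d) = 0%E.
  move=> mE e0 nE tE; exists e => //.
  apply/negligibleP; first by apply: measurableI.
  apply: (@negligibleS _ _ _ mu
    (E `&` [set x : R | exists2 d : R, 0 < d & mu (E `&` ball x d) = 0%E] `|` [set t])).
    move=> x [Ex]; rewrite -ball_normE/= distrC => xt.
    have [->|xnt] := eqVneq x t; [by right|left; split => //].
    by apply: tE; rewrite xt normr_gt0 subr_eq0 xnt.
  apply: negligibleU => //; apply/negligibleP => //.
  exact: lebesgue_measure_set1.
have halfline (E : set R) : measurable E -> mu E = +oo%E -> ~ (E `<=` locally_full).
  move=> mE Eoo sub; suff : (+oo < (+oo : \bar R))%E by rewrite ltxx.
  by rewrite -{1}Eoo; apply: le_lt_trans Afin; apply: le_measure => //; exact: mem_set.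
have [|||||||L sL AL] := @alternating_intervals R locally_full locally_null oA oB AB0 s.
- exact: ss.
- move=> x; have [Ax|nAx] := pselect (locally_full x); first by constructor 1.
  have [Bx|nBx] := pselect (locally_null x); first by constructor 2.
  by constructor 3; apply/sP/jumpP.
- by move=> x /sP/jumpP[].
- move=> t e /sP/jumpP[_ nBt] e0 tB; apply: nBt; apply: (punct _ _ e) => //.
  exact: locally_null_null.
- move=> t e /sP/jumpP[nAt _] e0 tA; apply: nAt; apply: (punct _ _ e) => //.
  exact: locally_null_null.
- move=> t tA; apply: (halfline `]t, +oo[%classic) => //.
    by rewrite lebesgue_measure_itv/= ?ltry ?ltNyr.
  by move=> x /=; rewrite in_itv/= andbT; exact: tA.
- move=> t tA; apply: (halfline `]-oo, t[%classic) => //.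
    by rewrite lebesgue_measure_itv/= ?ltry ?ltNyr.
exists L => //; rewrite -AL.
have fin0 : mu (jump_set G) = 0%E.
  by rewrite countable_lebesgue_measure0//; exact: finite_set_countable.
have mS : measurable (jump_set G).
  by apply: countable_measurable => //; exact: finite_set_countable.
(* The symmetric difference of [G] and [locally_full] is covered by three null pieces: [G] where it
   is locally null, its complement where it is locally full, and the jump points. *)
have : mu ((G `&` locally_null `|` jump_set G) `|` ~` G `&` locally_full) = 0%E.
  rewrite measureU0//; [|by apply: measurableU => //; by apply: measurableI|by apply: measurableI].
  by rewrite measureU0//; by apply: measurableI.
apply: null_subset.
- by apply: measurableU; apply: measurableD.
- by repeat (apply: measurableU || apply: measurableI) => //.
- move=> x [[Gx nAx]|[Ax nGx]]; [left|by right].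
  have [Bx|nBx] := pselect (locally_null x); [by left|right].
  exact/jumpP.
Qed.

End structure.

(** * Perimeter and reduced boundary of finite unions of intervals *)

Section gauss_green.
Context {R : realType}.
Notation mu := (@lebesgue_measure R).
Notation cmu := (@completed_lebesgue_measure R).

Definition right_ends (L : seq (R * R)) := [seq p.2 | p <- L].
Definition left_ends (L : seq (R * R)) := [seq p.1 | p <- L].

Lemma perm_ends (L : seq (R * R)) : perm_eq (ends L) (right_ends L ++ left_ends L).
Proof.
elim: L => [//|p L IH]; rewrite /ends /right_ends /left_ends/=.
rewrite -cat_cons perm_sym perm_catC/= perm_cons perm_catC/= perm_cons perm_sym.
exact: IH.
Qed.

Lemma uniq_ends (L : seq (R * R)) : sorted <%R (ends L) ->
  uniq (right_ends L ++ left_ends L).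
Proof. by move=> sL; rewrite -(perm_uniq (perm_ends L)); exact: lt_sorted_uniq. Qed.

Lemma gauss_green_union_itv (F : set R) (L : seq (R * R)) : sorted <%R (ends L) ->
  lebesgue_measurable F -> cmu (F `+` union_itv L) = 0%E ->
  forall phi : R -> R, C1c phi ->
  (\int[cmu]_(x in F) (derive1 phi x)%:E =
   (\sum_(b <- right_ends L) phi b - \sum_(a <- left_ends L) phi a)%:E)%E.
Proof.
move=> sL mF FL phi [[dphi cphi] _].
have mphi : measurable_fun setT (EFin \o derive1 phi).
  by apply/measurable_EFinP; exact: continuous_measurable_fun.
have mU := measurable_union_itv L.
rewrite (integral_symdiff_null mF (borel_lebesgue_measurable mU) FL); last first.
  exact: measurable_completed.
rewrite integral_completed//.
have dphi' (p : R * R) (x : R) : p \in L -> p.1 <= x <= p.2 ->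
    is_derive x 1 phi (derive1 phi x).
  by move=> _ _; rewrite derive1E; exact: derivableP.
by rewrite (integral_union_itv sL cphi dphi') /right_ends /left_ends !big_map sumrB.
Qed.

Lemma reduced_boundary_union_itv (F : set R) (L : seq (R * R)) : sorted <%R (ends L) ->
  lebesgue_measurable F -> cmu (F `+` union_itv L) = 0%E ->
  reduced_boundary F = [set` right_ends L ++ left_ends L].
Proof.
move=> sL mF FL; apply: reduced_boundaryE; last exact: uniq_ends.
exact: gauss_green_union_itv.
Qed.

Lemma perimeter_union_itv (F : set R) (L : seq (R * R)) : sorted <%R (ends L) ->
  lebesgue_measurable F -> cmu (F `+` union_itv L) = 0%E ->
  finite_perimeter F.
Proof.
move=> sL mF FL; split => //.
apply: (@le_lt_trans _ _ (\sum_(b <- right_ends L ++ left_ends L) 1)%:E); last exact: ltry.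
apply: ge_ereal_sup => _ [phi [cphi phi1] <-].
rewrite (gauss_green_union_itv sL mF FL cphi) lee_fin big_cat/= lerD//.
  by apply: ler_sum => x _; exact: le_trans (ler_norm _) (phi1 x).
by rewrite -sumrN; apply: ler_sum => x _; rewrite (le_trans (ler_norm _))// normrN.
Qed.

Lemma integral_counting_seq (s : seq R) (f : R -> R) : uniq s ->
  measurable_fun setT f -> (forall x, 0 <= f x) ->
  (\int[@counting R R]_(x in [set` s]) (f x)%:E = (\sum_(x <- s) f x)%:E)%E.
Proof.
move=> + mf f0; elim: s => [|x s IH] /=.
  by move=> _; rewrite set_nil integral_set0 big_nil.
move=> /andP[xs us]; have -> : [set` x :: s] = [set x] `|` [set` s].
  by apply/seteqP; split => y /=; rewrite inE => /predU1P.
rewrite ge0_integral_setU//=; last 4 first.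
- apply: countable_measurable; first by move=> t; exact: measurable_set1.
  exact/finite_set_countable/finite_seq.
- by apply: measurable_funTS; exact/measurable_EFinP.
- by move=> y _; rewrite lee_fin.
- by apply/disj_setPS => y [/= -> H]; move: xs; rewrite H.
rewrite IH// big_cons EFinD; congr (_ + _)%E.
rewrite (eq_integral (cst (f x)%:E)); last by move=> y /set_mem ->.
rewrite integral_cst; last exact: measurable_set1.
have c1 : @counting R R [set x] = 1%E.
  by rewrite /counting asboolT ?fset_set1 ?finmap.cardfs1//; exact: finite_set1.
by rewrite [X in (_ * X)%E]c1 mule1.
Qed.

Lemma finite_perimeter_structure (F : set R) : finite_perimeter F ->
  (cmu F < +oo)%E ->
  exists2 L, sorted <%R (ends L) & cmu (F `+` union_itv L) = 0%E.
Proof.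
move=> [mF pF] Foo; have [G mG FG] := borel_representative mF.
have mG' := borel_lebesgue_measurable mG.
have Goo : (mu G < +oo)%E.
  have : (cmu G <= cmu F + cmu (F `+` G))%E.
    apply: le_trans (measureU2 _ _ _) => //; last first.
      by apply: measurableU; apply: measurableD.
    apply: le_measure; [exact: mem_set| |].
      by apply: mem_set; apply: measurableU => //; apply: measurableU; apply: measurableD.
    by move=> x Gx; have [Fx|nFx] := pselect (F x); [left|right; right].
  by rewrite FG adde0 => /le_lt_trans; apply.
have [M MF] : exists M : R, (perimeter F <= M%:E)%E.
  by case: (perimeter F) pF => [M _|//|_]; [exists M|exists 0; rewrite leNye].
have [|L sL GL] := @finite_perimeter_union_itv _ G mG Goo M.
  move=> phi cphi phi1; apply: le_trans MF; apply: ereal_sup_ubound.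
  exists phi => //; have [[dphi c'phi] _] := cphi.
  have mphi : measurable_fun setT (EFin \o derive1 phi).
    by apply/measurable_EFinP; exact: continuous_measurable_fun.
  rewrite (integral_symdiff_null mF mG' FG); last exact: measurable_completed.
  exact: integral_completed.
exists L => //.
have mU := borel_lebesgue_measurable (measurable_union_itv L).
apply/eqP; rewrite eq_le measure_ge0 andbT.
have : (cmu (F `+` union_itv L) <= cmu (F `+` G) + cmu (G `+` union_itv L))%E.
  apply: le_trans (measureU2 _ _ _); last 2 first.
  - by apply: measurableU; apply: measurableD.
  - by apply: measurableU; apply: measurableD.
  apply: le_measure; last 1 first.
  - move=> x [[Fx nUx]|[Ux nFx]]; have [Gx|nGx] := pselect (G x).
    + by right; left.
    + by left; left.
    + by left; right.
    + by right; right.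
  - by apply: mem_set; apply: measurableU; apply: measurableD.
  - by apply: mem_set; apply: measurableU; apply: measurableU; apply: measurableD.
by rewrite FG [X in (_ + X)%E]GL adde0.
Qed.

End gauss_green.

(** * Calibration *)

Section weights.
Context {R : realType}.
Notation mu := (@lebesgue_measure R).
Variables psi g : R -> R.
Hypothesis adm : admissible psi g.

Let psi_ge0 x : 0 <= psi x. Proof. by case: adm => -[]. Qed.
Let g_ge0 x : 0 <= g x. Proof. by case: adm => -[]. Qed.
Let dpsi (x : R) : derivable psi x 1. Proof. by case: adm => _ [[]]. Qed.
Let ddpsi (x : R) : derivable (derive1 psi) x 1. Proof. by case: adm => _ [[_ []]]. Qed.
Let dg (x : R) : derivable g x 1. Proof. by case: adm => _ [_ []]. Qed.
Let dpsi0 : derive1 psi 0 = 0. Proof. by case: adm. Qed.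

Local Notation f := (density psi).

Let continuous_of_derivable (h : R -> R) : (forall x : R, derivable h x 1) -> continuous h.
Proof.
by move=> dh x; apply: differentiable_continuous; apply/derivable1_diffP; exact: dh.
Qed.

Let continuous_radial (h : R -> R) : (forall x : R, derivable h x 1) ->
  continuous (fun x : R => h `|x|).
Proof.
move=> dh x; apply: continuous_comp; first exact: norm_continuous.
exact: continuous_of_derivable.
Qed.

Lemma density_ge1 x : 1 <= f x.
Proof. by rewrite /density -expR0 ler_expR. Qed.

Lemma density_gt0 x : 0 < f x.
Proof. exact: expR_gt0. Qed.

Lemma continuous_density : continuous f.
Proof.
move=> x; apply: continuous_comp; first exact: continuous_radial.
exact: continuous_expR.
Qed.

Definition bulk (x : R) : R := g `|x| * f x.
(* [drift x] is [sgn(x) * f'(x)], where [f] is the density. *)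
Definition drift (x : R) : R := derive1 psi `|x| * f x.

Lemma continuous_bulk : continuous bulk.
Proof.
by move=> x; apply: cvgM; [exact: continuous_radial|exact: continuous_density].
Qed.

Lemma continuous_drift : continuous drift.
Proof.
by move=> x; apply: cvgM; [exact: continuous_radial|exact: continuous_density].
Qed.

Lemma bulk_ge0 x : 0 <= bulk x.
Proof. by rewrite mulr_ge0// ltW// density_gt0. Qed.

Definition drift_primitive (x : R) : R := Num.sg x * (f x - f 0).

Let is_derive_expR_psi (x : R) :
  is_derive x 1 (fun y => expR (psi y)) (derive1 psi x * expR (psi x)).
Proof.
have dx : is_derive x 1 psi (derive1 psi x) by rewrite derive1E; exact: derivableP.
by rewrite mulrC; apply: is_derive1_comp.
Qed.

(** Away from 0 this is the chain rule on each half-line. At 0 the difference quotient at [h] has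
    the same absolute value as that of [exp (psi y)] at [|h|], which tends to 0 because [psi] has
    derivative 0 there. *)
Lemma is_derive_drift (x : R) : is_derive x 1 drift_primitive (drift x).
Proof.
have [x0|x0|->] := ltgtP x 0.
- apply: (@near_eq_is_derive _ _ _ (fun y => f 0 - expR (psi (- y)))).
    near=> y.
    have y0 : y < 0 by near: y; exact: lt_nbhsl.
    by rewrite /drift_primitive /density (ltr0_sg y0) (ltr0_norm y0) mulN1r opprB.
  have D : is_derive x 1 (fun y => expR (psi (- y)))
      (- (derive1 psi (- x) * expR (psi (- x)))).
    have H := is_derive_expR_psi (- x).
    have := @is_derive1_comp _ (fun y => expR (psi y)) -%R x _ _ H (is_deriveNid x 1).
    by rewrite mulrN1.
  have := is_deriveB (is_derive_cst (f 0) x 1) D.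
  by rewrite sub0r opprK /drift /density (ltr0_norm x0).
- apply: (@near_eq_is_derive _ _ _ (fun y => expR (psi y) - f 0)).
    near=> y.
    have y0 : 0 < y by near: y; exact: lt_nbhsr.
    by rewrite /drift_primitive /density (gtr0_sg y0) (gtr0_norm y0) mul1r.
  have := is_deriveB (is_derive_expR_psi x) (is_derive_cst (f 0) x 1).
  by rewrite subr0 /drift /density (gtr0_norm x0).
- have := is_derive_expR_psi 0; rewrite dpsi0 mul0r => -[/cvg_ex[/= l cl] lE].
  have l0 : l = 0 by rewrite -lE; apply/esym/cvg_lim.
  have E : drift 0 = 0 by rewrite /drift normr0 dpsi0 mul0r.
  suff H : h^-1 *: ((drift_primitive \o shift 0) (h *: (1 : R)) - drift_primitive 0)
      @[h --> 0^'] --> (0 : R).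
    by rewrite E; split; [apply/cvg_ex; exists 0|apply: cvg_lim].
  move/cvgrPdist_lt in cl; apply/cvgrPdist_lt => e e0.
  have := cl e e0; rewrite l0 => -[d /= d0 H]; exists d => //= h hd hn0.
  have := H `|h|; rewrite /= !sub0r !normrN normr_id => /(_ _ _)/wrap[].
  + by move: hd; rewrite /= sub0r normrN.
  + by rewrite normr_eq0.
  rewrite /drift_primitive /density /GRing.scale/= !mulr1 !addr0 !normr0 subrr mulr0 subr0.
  by rewrite !normrM !normfV normr_id normr_sg hn0 mul1r.
Unshelve. all: by end_near. Qed.

Lemma drift_primitive_cases (x : R) : drift_primitive x = f x - f 0 \/
  drift_primitive x = - (f x - f 0).
Proof.
rewrite /drift_primitive; case: (sgrP x) => [->|_|_]; [left|left|right].
- by rewrite subrr mul0r.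
- by rewrite mul1r.
- by rewrite mulN1r.
Qed.

Lemma drift_primitive_itv (r : R) : 0 < r ->
  drift_primitive r - drift_primitive (- r) = 2 * (f r - f 0).
Proof.
move=> r0; have fN : f (- r) = f r by rewrite /density normrN.
by rewrite /drift_primitive sgrN gtr0_sg// fN; ring.
Qed.

Hypothesis psi_min : forall x, 0 <= x -> psi 0 <= psi x.

Lemma density_min x : f 0 <= f x.
Proof. by rewrite /density ler_expR normr0 psi_min. Qed.

(** Write K for [drift_primitive], which is [f - f 0] up to sign. Then [f b - K b] and [f a + K a]
    are each at least [f 0], so every interval leaves a surplus of [2 f 0]; one interval's surplus
    is kept and the others are discarded. *)
Lemma perimeter_calibration (L : seq (R * R)) : L != [::] ->
  2 * f 0 + \sum_(p <- L) (drift_primitive p.2 - drift_primitive p.1) <=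
  \sum_(p <- L) (f p.2 + f p.1).
Proof.
have step1 p : 2 * f 0 + (drift_primitive p.2 - drift_primitive p.1) <= f p.2 + f p.1.
  have := density_min p.1; have := density_min p.2.
  have [->|->] := drift_primitive_cases p.1; have [->|->] := drift_primitive_cases p.2; lra.
case: L => [//|p L] _; rewrite !big_cons addrA lerD//.
apply: ler_sum => q _; apply: le_trans (step1 q).
by rewrite lerDr mulr_ge0// ltW// density_gt0.
Qed.

End weights.

Section monotone.
Context {R : realType}.
Variables psi g : R -> R.
Hypothesis adm : admissible psi g.

(** Along centered intervals this is the derivative of energy with respect to volume, hence the
    natural Lagrange multiplier. Moreover [drift + bulk] equals [forcing] at [|x|] times the
    density. *)
Definition forcing (r : R) : R := derive1 psi r + g r.

Lemma is_derive_forcing (x : R) :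
  is_derive x 1 forcing (derive1 (derive1 psi) x + derive1 g x).
Proof.
case: adm => _ [[_ [dd _]] [dg _] _] _ _.
have D1 : is_derive x 1 (derive1 psi) (derive1 (derive1 psi) x).
  by rewrite (derive1E (derive1 psi)); apply: derivableP.
have D2 : is_derive x 1 g (derive1 g x).
  by rewrite (derive1E g); apply: derivableP.
exact: is_deriveD.
Qed.

Let cf : continuous forcing.
Proof.
move=> x; apply: differentiable_continuous; apply/derivable1_diffP.
by case: (is_derive_forcing x).
Qed.

Let d1f x : derive1 forcing x = derive1 (derive1 psi) x + derive1 g x.
Proof. by rewrite derive1E; have ? := is_derive_forcing x; exact: derive_val. Qed.

Lemma forcing_nondecreasing (x y : R) : 0 <= x -> x <= y -> forcing x <= forcing y.
Proof.
move=> x0 xy; apply: (@ger0_derive1_le_cc _ forcing 0 y) => //.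
- by move=> z _; case: (is_derive_forcing z).
- move=> z; rewrite in_itv/= => /andP[z0 _]; rewrite d1f.
  by case: adm => _ _ _; apply; exact: ltW.
- exact: continuous_subspaceT.
- by rewrite in_itv/= x0.
- by rewrite in_itv/= lexx (le_trans x0).
Qed.

Hypothesis sadm : strictly_admissible psi g.

Lemma forcing_increasing (x y : R) : 0 <= x -> x < y -> forcing x < forcing y.
Proof.
move=> x0 xy; apply: (@gtr0_derive1_lt_cc _ forcing 0 y) => //.
- by move=> z _; case: (is_derive_forcing z).
- move=> z; rewrite in_itv/= => /andP[z0 _]; rewrite d1f.
  by case: sadm => _; apply.
- exact: continuous_subspaceT.
- by rewrite in_itv/= x0 ltW.
- by rewrite in_itv/= lexx (le_trans x0)// ltW.
Qed.

End monotone.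

(** A nonnegative integrand with zero integral vanishes almost everywhere on [D], while its zeros
    are confined to the null set [Z]. *)
Lemma integral_eq0_null {R : realType} (h : R -> R) (D Z : set R) :
  measurable Z -> lebesgue_measure Z = 0%E -> (forall x, h x = 0 -> Z x) ->
  measurable D -> lebesgue_measure.-integrable D (EFin \o h) ->
  (forall x, D x -> 0 <= h x) ->
  \int[lebesgue_measure]_(x in D) h x = 0 -> lebesgue_measure D = 0%E.
Proof.
move=> mZ Z0 hZ mD iD h0 E.
have E' : (\int[lebesgue_measure]_(x in D) `|(EFin \o h) x| = 0)%E.
  transitivity (\int[lebesgue_measure]_(x in D) (h x)%:E)%E.
    by apply: eq_integral => x /set_mem Dx; rewrite /= ger0_norm// h0.
  by rewrite -[LHS]fineK; [rewrite [fine _]E|exact: integrable_fin_num].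
have mh : measurable_fun D (EFin \o h) by exact: measurable_int iD.
have nD := (ae_eq_integral_abs lebesgue_measure mD mh).1 E'.
apply/negligibleP => //.
apply: (@negligibleS _ _ _ lebesgue_measure
  (~` [set x | D x -> (EFin \o h) x = cst 0%E x] `|` Z)).
  move=> x Dx; have [Zx|nZx] := pselect (Z x); [by right|left => /(_ Dx) /= [hx]].
  by apply: nZx; exact: hZ.
by apply: negligibleU => //; exact/negligibleP.
Qed.

(** * The bathtub comparison, with the volume constraint absorbed in the integrand *)

Section bathtub.
Context {R : realType}.
Notation mu := (@lebesgue_measure R).
Variables (w : R -> R) (U I : set R).
Hypotheses (mU : measurable U) (mI : measurable I).
Hypotheses (iU : mu.-integrable U (EFin \o w)) (iI : mu.-integrable I (EFin \o w)).
Hypothesis wI : forall x, I x -> w x <= 0.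
Hypothesis wCI : forall x, ~ I x -> 0 <= w x.

Let split_integral (A B : set R) : measurable A -> measurable B ->
  mu.-integrable A (EFin \o w) ->
  \int[mu]_(x in A) w x = \int[mu]_(x in A `&` B) w x + \int[mu]_(x in A `\` B) w x.
Proof.
move=> mA mB iA; rewrite -Rintegral_setU ?setUIDK//.
- by apply: measurableI.
- by apply: measurableD.
- by apply/disj_setPS => x [[_ ?] [_ ?]].
Qed.

Let mUI : measurable (U `\` I). Proof. by apply: measurableD. Qed.
Let mIU : measurable (I `\` U). Proof. by apply: measurableD. Qed.

Let iUI : mu.-integrable (U `\` I) (EFin \o w).
Proof. exact: (@integrableS _ _ _ mu U (U `\` I) _ mU mUI (@subDsetl _ _ _) iU). Qed.

Let iIU : mu.-integrable (I `\` U) (EFin \o w).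
Proof. exact: (@integrableS _ _ _ mu I (I `\` U) _ mI mIU (@subDsetl _ _ _) iI). Qed.

Let diff_ge0 : 0 <= \int[mu]_(x in U `\` I) w x.
Proof. by apply: Rintegral_ge0 => x [_ /wCI]. Qed.

Let opp_diff : \int[mu]_(x in I `\` U) (-1 * w x) = - \int[mu]_(x in I `\` U) w x.
Proof. by rewrite (@RintegralZl _ (measurableTypeR R) R mu (I `\` U) w (-1) mIU iIU) mulN1r. Qed.

Let diff_le0 : \int[mu]_(x in I `\` U) w x <= 0.
Proof.
rewrite -oppr_ge0 -opp_diff; apply: Rintegral_ge0 => x [/wI].
by rewrite mulN1r oppr_ge0.
Qed.

(** The common part of [U] and [I] cancels; what remains of [I] contributes at most 0 and what
    remains of [U] at least 0. *)
Lemma bathtub_le : \int[mu]_(x in I) w x <= \int[mu]_(x in U) w x.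
Proof.
rewrite (split_integral mU mI iU) (split_integral mI mU iI) setIC.
by rewrite lerD2l (le_trans diff_le0).
Qed.

(** Equality forces both one-sided differences to have zero integral, although [w] has a strict sign
    there off the null set [Z]. *)
Lemma bathtub_eq (Z : set R) : measurable Z -> mu Z = 0%E ->
  (forall x, w x = 0 -> Z x) ->
  \int[mu]_(x in I) w x = \int[mu]_(x in U) w x -> mu (U `+` I) = 0%E.
Proof.
move=> mZ Z0 wZ.
rewrite (split_integral mU mI iU) (split_integral mI mU iI) setIC => /addrI E.
have E1 : \int[mu]_(x in U `\` I) w x = 0.
  by apply/eqP; rewrite eq_le diff_ge0 andbT -E diff_le0.
have E2 : \int[mu]_(x in I `\` U) (-1 * w x) = 0 by rewrite opp_diff E E1 oppr0.
rewrite measureU0//.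
- by apply: (integral_eq0_null mZ Z0 wZ) => // x [_ /wCI].
- apply: (@integral_eq0_null _ (fun x => -1 * w x) _ Z) => //.
  + by move=> x; rewrite mulN1r => /eqP; rewrite oppr_eq0 => /eqP /wZ.
  + exact: (@integrableZl _ (measurableTypeR R) R mu (I `\` U) mIU (-1) _ iIU).
  + by move=> x [/wI]; rewrite mulN1r oppr_ge0.
Qed.

End bathtub.

Section minimality.
Context {R : realType}.
Notation mu := (@lebesgue_measure R).
Notation cmu := (@completed_lebesgue_measure R).
Variables psi g : R -> R.
Hypothesis adm : admissible psi g.
Local Notation f := (density psi).
Local Notation bulk := (bulk psi g).
Local Notation drift := (drift psi).
Local Notation drift_primitive := (drift_primitive psi).
Local Notation forcing := (forcing psi g).

Let cf := continuous_density adm.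
Let cb := continuous_bulk adm.
Let cd := continuous_drift adm.

Lemma EFin_integral_union_itv (h : R -> R) L : continuous h ->
  (\int[mu]_(x in union_itv L) (h x)%:E = (\int[mu]_(x in union_itv L) h x)%:E)%E.
Proof.
move=> ch; rewrite /Rintegral fineK//.
apply: integrable_fin_num; first exact: measurable_union_itv.
exact: integrable_union_itv.
Qed.

Section union_itv_functionals.
Variables (F : set R) (L : seq (R * R)).
Hypotheses (sL : sorted <%R (ends L)) (mF : lebesgue_measurable F).
Hypothesis FL : cmu (F `+` union_itv L) = 0%E.

Lemma integral_ae_union_itv (h : R -> R) : continuous h ->
  (\int[cmu]_(x in F) (h x)%:E = (\int[mu]_(x in union_itv L) h x)%R%:E)%E.
Proof.
move=> ch; have mh : measurable_fun setT (EFin \o h).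
  by apply/measurable_EFinP; exact: continuous_measurable_fun.
have mU := measurable_union_itv L.
rewrite (integral_symdiff_null mF (borel_lebesgue_measurable mU) FL); last first.
  exact: measurable_completed.
by rewrite integral_completed// EFin_integral_union_itv.
Qed.

Lemma volume_ae_union_itv :
  weighted_volume psi F = (\int[mu]_(x in union_itv L) f x)%:E.
Proof. exact: integral_ae_union_itv. Qed.

Lemma energy_ae_union_itv : energy psi g F =
  (\sum_(p <- L) (f p.2 + f p.1) + \int[mu]_(x in union_itv L) bulk x)%:E.
Proof.
rewrite /energy (integral_ae_union_itv cb) (reduced_boundary_union_itv sL mF FL).
rewrite integral_counting_seq ?uniq_ends//; last 2 first.
- exact: continuous_measurable_fun.
- by move=> x; exact/ltW/density_gt0.
by rewrite big_cat/= /right_ends /left_ends !big_map -big_split.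
Qed.

End union_itv_functionals.

Lemma integral_drift L : sorted <%R (ends L) ->
  \int[mu]_(x in union_itv L) drift x =
  \sum_(p <- L) (drift_primitive p.2 - drift_primitive p.1).
Proof.
move=> sL; apply: EFin_inj; rewrite -EFin_integral_union_itv//.
by rewrite (integral_union_itv sL cd (fun _ x _ _ => is_derive_drift adm x)).
Qed.

Section comparison.
Variables (r : R) (L : seq (R * R)).
Hypotheses (r0 : 0 < r) (sL : sorted <%R (ends L)) (L0 : L != [::]).
Hypothesis psi_min : forall x, 0 <= x -> psi 0 <= psi x.
Let I := [:: (- r, r)].
Hypothesis eq_vol : \int[mu]_(x in union_itv L) f x = \int[mu]_(x in union_itv I) f x.

Let sI : sorted <%R (ends I). Proof. by rewrite /I /= andbT gtrN. Qed.

(** The multiplier [forcing r] places the sign change at [|x| = r], and its contribution cancels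
    between sets of equal volume. *)
Let excess (x : R) : R := drift x + bulk x - forcing r * f x.

Let c_excess : continuous excess.
Proof.
move=> x; apply: cvgB; first by apply: cvgD; [exact: cd|exact: cb].
by apply: cvgM; [exact: cvg_cst|exact: cf].
Qed.

Let excessE x : excess x = (forcing `|x| - forcing r) * f x.
Proof. by rewrite /excess /drift /bulk /forcing; ring. Qed.

Let integral_excess L' : \int[mu]_(x in union_itv L') excess x =
  \int[mu]_(x in union_itv L') drift x + \int[mu]_(x in union_itv L') bulk x -
  forcing r * \int[mu]_(x in union_itv L') f x.
Proof.
have mU := measurable_union_itv L'.
have id := integrable_union_itv L' cd.
have ib := integrable_union_itv L' cb.
have if_ := integrable_union_itv L' cf.
have cdb : continuous (fun x => drift x + bulk x).
  by move=> x; apply: cvgD; [exact: cd|exact: cb].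
have ccf : continuous (fun x => forcing r * f x).
  by move=> x; apply: cvgM; [exact: cvg_cst|exact: cf].
rewrite -(@RintegralD _ (measurableTypeR R) R mu _ _ _ mU id ib).
rewrite -(@RintegralZl _ (measurableTypeR R) R mu _ _ _ mU if_).
by rewrite -(@RintegralB _ (measurableTypeR R) R mu _ _ _ mU
  (integrable_union_itv L' cdb) (integrable_union_itv L' ccf)).
Qed.

Let inI x : union_itv I x <-> `|x| < r.
Proof.
have -> : union_itv I = `]- r, r[%classic by exact: setU0.
by rewrite /= in_itv/= ltr_norml.
Qed.

Let excess_le0 x : union_itv I x -> excess x <= 0.
Proof.
move=> /inI xr; rewrite excessE pmulr_lle0 ?density_gt0// subr_le0.
by rewrite (forcing_nondecreasing adm)// ltW.
Qed.

Let excess_ge0 x : ~ union_itv I x -> 0 <= excess x.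
Proof.
move=> /inI/negP; rewrite -leNgt => rx; rewrite excessE mulr_ge0//; last first.
  exact/ltW/density_gt0.
by rewrite subr_ge0 (forcing_nondecreasing adm)// ltW.
Qed.

Let drift_I : \int[mu]_(x in union_itv I) drift x = 2 * f r - 2 * f 0.
Proof.
rewrite integral_drift// /I big_seq1/= drift_primitive_itv//; ring.
Qed.

Let mI := measurable_union_itv I.
Let mU := measurable_union_itv L.
Let iI := integrable_union_itv I c_excess.
Let iU := integrable_union_itv L c_excess.

Lemma centered_le :
  2 * f r + \int[mu]_(x in union_itv I) bulk x <=
  \sum_(p <- L) (f p.2 + f p.1) + \int[mu]_(x in union_itv L) bulk x.
Proof.
(* Once the volume terms cancel, the drift integral becomes exactly [2 f r - 2 f 0] on the centered
   interval, and at most the boundary sum minus [2 f 0] on the competitor. *)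
have := bathtub_le mU mI iU iI excess_le0 excess_ge0.
rewrite !integral_excess eq_vol drift_I integral_drift//.
by have := perimeter_calibration psi_min L0; lra.
Qed.

Lemma centered_unique : strictly_admissible psi g ->
  \sum_(p <- L) (f p.2 + f p.1) + \int[mu]_(x in union_itv L) bulk x <=
  2 * f r + \int[mu]_(x in union_itv I) bulk x ->
  mu (union_itv L `+` union_itv I) = 0%E.
Proof.
move=> sadm leI.
apply: (bathtub_eq mU mI iU iI excess_le0 excess_ge0 (Z := [set` [:: r; - r]])).
- apply: countable_measurable; first by move=> t; exact: measurable_set1.
  exact/finite_set_countable/finite_seq.
- apply: countable_lebesgue_measure0.
  exact/finite_set_countable/finite_seq.
- move=> x /eqP; rewrite excessE mulf_eq0 (gt_eqF (density_gt0 psi x)) orbF subr_eq0 => /eqP E.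
  suff : `|x| == r by rewrite eqr_norml /= !inE => /andP[].
  case: (ltgtP `|x| r) => // H.
    by have := forcing_increasing adm sadm (normr_ge0 x) H; rewrite E ltxx.
  by have := forcing_increasing adm sadm (ltW r0) H; rewrite E ltxx.
(* The assumed reverse inequality closes the chain, so the bathtub inequality becomes the equality
   required here. *)
- have := bathtub_le mU mI iU iI excess_le0 excess_ge0.
  rewrite !integral_excess eq_vol drift_I integral_drift//.
  by have := perimeter_calibration psi_min L0; lra.
Qed.

End comparison.

End minimality.

(** * Existence of centered intervals, minimality, and the converse *)

Section intervals.
Context {R : realType}.
Notation mu := (@lebesgue_measure R).
Notation cmu := (@completed_lebesgue_measure R).
Variables psi g : R -> R.
Hypothesis adm : admissible psi g.
Local Notation f := (density psi).
Local Notation bulk := (bulk psi g).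

Let cf := continuous_density adm.
Let cb := continuous_bulk adm.

Lemma union_itv1 (a b : R) : union_itv [:: (a, b)] = `]a, b[%classic.
Proof. exact: setU0. Qed.

Lemma interval_ae (a b : R) : cmu (`]a, b[ `+` union_itv [:: (a, b)]) = 0%E.
Proof. by rewrite union_itv1 setYK measure0. Qed.

Lemma interval_lebesgue_measurable (a b : R) : lebesgue_measurable `]a, b[%classic.
Proof. by apply: borel_lebesgue_measurable. Qed.

Lemma sorted_interval (a b : R) : a < b -> sorted <%R (ends [:: (a, b)]).
Proof. by move=> ab; rewrite /= ab. Qed.

Lemma integral_itv_primitive (h H : R -> R) (M a b : R) : continuous h ->
  (forall x : R, `|x| < M -> is_derive x 1 H (h x)) ->
  - M < a -> a <= b -> b < M ->
  \int[mu]_(x in `]a, b[) h x = H b - H a.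
Proof.
move=> ch dH Ma ab bM.
have dH' (x : R) : a <= x <= b -> is_derive x 1 H (h x).
  by move=> /andP[ax xb]; apply: dH; rewrite ltr_norml; apply/andP; split; lra.
by rewrite /Rintegral (FTC_oo ab ch dH').
Qed.

Lemma volume_ge_length (a b : R) : a <= b -> b - a <= \int[mu]_(x in `]a, b[) f x.
Proof.
move=> ab.
have <- : \int[mu]_(x in `]a, b[) (1 : R) = b - a.
  rewrite Rintegral_cst// mul1r; have /= E := @lebesgue_measure_itv R `]a, b[%R.
  rewrite [mu _]E lte_fin.
  by move: ab; rewrite le_eqVlt => /predU1P[->|->]; rewrite ?ltxx ?subrr.
apply: le_Rintegral => //.
- have := @integrable_union_itv _ (cst 1) [:: (a, b)]; rewrite union_itv1.
  by apply => x; exact: cvg_cst.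
- by have := integrable_union_itv [:: (a, b)] cf; rewrite union_itv1.
- by move=> x _; exact: density_ge1 adm x.
Qed.

(** Intermediate value theorem on [[0, v]]: the density is at least 1, so the interval of radius [v]
    already has volume at least [2 v]. The primitive is taken on a window with margin 1 around these
    radii. *)
Lemma centered_volume (v : R) : 0 < v ->
  exists2 r : R, 0 < r & \int[mu]_(x in union_itv [:: (- r, r)]) f x = v.
Proof.
move=> v0; have [H dH] := primitive_exists (v + 1) cf.
have VE (r : R) : 0 <= r <= v -> \int[mu]_(x in `]- r, r[) f x = H r - H (- r).
  move=> /andP[rge0 rv]; apply: (integral_itv_primitive cf dH); lra.
have cH x : `|x| < v + 1 -> {for x, continuous H}.
  by move=> xv; have [d _] := dH x xv; apply: differentiable_continuous; apply/derivable1_diffP.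
have [||r] := @IVT _ (fun r => H r - H (- r)) 0 v v (ltW v0).
- apply: continuous_in_subspaceT => x /set_mem; rewrite /= in_itv/= => /andP[x0 xv].
  apply: cvgB; first by apply: cH; rewrite ger0_norm//; lra.
  apply: continuous_comp; first exact: opp_continuous.
  by apply: cH; rewrite normrN ger0_norm//; lra.
- rewrite oppr0 subrr; have := @volume_ge_length (- v) v.
  rewrite VE ?lexx ?andbT; last exact: ltW.
  move=> /(_ _)/wrap[]; first lra.
  by move=> vV; rewrite ge_min le_max (ltW v0)/=; apply/orP; right; lra.
rewrite in_itv/= => /andP[rge0 rv] Hr; exists r; last by rewrite setU0 VE ?rge0.
rewrite lt_neqAle rge0 andbT; apply/eqP => r0.
by move: Hr v0; rewrite -r0 oppr0 subrr => <-; rewrite ltxx.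
Qed.

Lemma energy_interval (a b : R) : a < b ->
  energy psi g `]a, b[%classic = (f b + f a + \int[mu]_(x in `]a, b[) bulk x)%:E.
Proof.
move=> ab; rewrite (energy_ae_union_itv adm (sorted_interval ab)
  (interval_lebesgue_measurable a b) (interval_ae a b)).
by rewrite big_seq1 union_itv1.
Qed.

Lemma volume_interval (a b : R) :
  weighted_volume psi `]a, b[%classic = (\int[mu]_(x in `]a, b[) f x)%:E.
Proof.
by rewrite (volume_ae_union_itv adm (interval_lebesgue_measurable a b)
  (interval_ae a b)) union_itv1.
Qed.

Lemma finite_perimeter_interval (a b : R) : a < b -> finite_perimeter `]a, b[%classic.
Proof.
move=> ab; exact: (perimeter_union_itv (sorted_interval ab)
  (interval_lebesgue_measurable a b) (interval_ae a b)).
Qed.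

Lemma densityN (x : R) : f (- x) = f x.
Proof. by rewrite /density normrN. Qed.

(** The density being at least 1, the Lebesgue measure is bounded by the volume, so the structure
    result applies; positive volume excludes the empty list. *)
Lemma finite_volume_structure (F : set R) (v : R) : finite_perimeter F ->
  weighted_volume psi F = v%:E -> 0 < v ->
  exists L, [/\ sorted <%R (ends L), cmu (F `+` union_itv L) = 0%E, L != [::] &
    \int[mu]_(x in union_itv L) f x = v].
Proof.
move=> pF vF v0; have [mF _] := pF.
have [|L sL FL] := finite_perimeter_structure pF.
  apply: (@le_lt_trans _ _ (weighted_volume psi F)); last by rewrite vF ltry.
  rewrite -(mul1e (cmu F)) -integral_cst//; apply: ge0_le_integral => //.
  - apply: measurable_funTS; apply: (@measurable_completed _ (EFin \o f)).
    by apply/measurable_EFinP; exact: continuous_measurable_fun.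
  - by move=> x _; rewrite lee_fin; exact: density_ge1 adm x.
have vL := volume_ae_union_itv adm mF FL.
have {}vL : \int[mu]_(x in union_itv L) f x = v by apply: EFin_inj; rewrite -vL.
exists L; split => //; apply/eqP => L0.
by move: vL v0; rewrite L0 Rintegral_set0 => <-; rewrite ltxx.
Qed.

Section centered_minimizer.
Hypothesis psi_min : forall x, 0 <= x -> psi 0 <= psi x.
Variables (r v : R).
Hypotheses (r0 : 0 < r) (v0 : 0 < v).
Hypothesis rv : \int[mu]_(x in union_itv [:: (- r, r)]) f x = v.

Let nrr : - r < r. Proof. by rewrite gtrN. Qed.

Let energy_centered : energy psi g (centered_interval r) =
  (2 * f r + \int[mu]_(x in union_itv [:: (- r, r)]) bulk x)%:E.
Proof.
by rewrite /centered_interval energy_interval// union_itv1 densityN mulr2n mulrDl mul1r.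
Qed.

Lemma centered_minimizer : is_minimizer psi g v (centered_interval r).
Proof.
split; first exact: finite_perimeter_interval.
  by rewrite /centered_interval volume_interval -union_itv1 rv.
move=> E pE vE; have [L [sL EL L0 vL]] := finite_volume_structure pE vE v0.
rewrite energy_centered (energy_ae_union_itv adm sL pE.1 EL) lee_fin.
by apply: centered_le => //; rewrite vL rv.
Qed.

Lemma minimizer_unique (F : set R) : strictly_admissible psi g ->
  is_minimizer psi g v F -> cmu (F `+` centered_interval r) = 0%E.
Proof.
move=> sadm [pF vF minF]; have [L [sL FL L0 vL]] := finite_volume_structure pF vF v0.
have [pI vI _] := centered_minimizer.
have := minF _ pI vI.
rewrite energy_centered (energy_ae_union_itv adm sL pF.1 FL) lee_fin.
move=> /(centered_unique adm r0 sL L0 psi_min _ sadm); rewrite vL rv => /(_ erefl).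
rewrite union_itv1 -/(centered_interval r) => LI.
have mF := pF.1.
have mL := borel_lebesgue_measurable (measurable_union_itv L).
have mI := interval_lebesgue_measurable (- r) r.
apply/eqP; rewrite eq_le measure_ge0 andbT.
have : (cmu (F `+` centered_interval r) <=
    cmu (F `+` union_itv L) + cmu (union_itv L `+` centered_interval r))%E.
  apply: le_trans (measureU2 _ _ _); last 2 first.
  - by apply: measurableU; apply: measurableD.
  - by apply: measurableU; apply: measurableD.
  apply: le_measure; last 1 first.
  - move=> x [[Fx nIx]|[Ix nFx]]; have [Lx|nLx] := pselect (union_itv L x).
    + by right; left.
    + by left; left.
    + by left; right.
    + by right; right.
  - by apply: mem_set; apply: measurableU; apply: measurableD.
  - by apply: mem_set; apply: measurableU; apply: measurableU; apply: measurableD.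
by rewrite FL [X in (_ + X)%E]LI adde0.
Qed.

End centered_minimizer.

Lemma centered_minimizers_min :
  (forall v : R, 0 < v ->
     exists2 r : R, 0 < r & is_minimizer psi g v (centered_interval r)) ->
  forall x, 0 <= x -> psi 0 <= psi x.
Proof.
move=> minv x0 x0_ge0; rewrite leNgt; apply/negP => psi_lt.
(* The short interval costs less than [2 f x0 + 2 eta], the centered one more than [2 f 0 - 2 eta];
   the gap [2 (f 0 - f x0) = 8 eta] exceeds the losses. *)
pose eta := (f 0 - f x0) / 4.
have eta0 : 0 < eta.
  by rewrite divr_gt0// subr_gt0 /density ltr_expR normr0 ger0_norm.
have [H dH] := primitive_exists (x0 + 2) cb.
have [V dV] := primitive_exists (x0 + 2) cf.
have x0M : `|x0| < x0 + 2 by rewrite ger0_norm//; lra.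
have cont (h K : R -> R) : is_derive x0 1 K (h x0) -> {for x0, continuous K}.
  by move=> [d _]; apply: differentiable_continuous; apply/derivable1_diffP.
have cH := cont _ _ (dH _ x0M).
have cV := cont _ _ (dV _ x0M).
have cfx : {for x0, continuous f} by exact: cf.
have : {for (0 : R), continuous f} by exact: cf.
move=> /cvgrPdist_lt/(_ _ eta0)/nbhs_ballP[d /= d0 fd].
(* [y] is taken so close to [x0] that the right endpoint costs at most [eta] more than the left one,
   the bulk term is below [eta], and the volume is below [d], within which the density stays
   [eta]-close to [f 0]. *)
have /(@filter_ex _ (x0^'+)) : \forall y \near x0^'+,
    [/\ x0 < y, y < x0 + 1, f y < f x0 + eta, H y < H x0 + eta & V y < V x0 + d].
  near=> y; split.
  - by [].
  - by near: y; apply: nbhs_right_lt; rewrite ltrDl.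
  - rewrite -ltrBlDl; apply: le_lt_trans (ler_norm _) _; rewrite distrC.
    by near: y; apply: cvg_within; move/cvgrPdist_lt: cfx; apply.
  - rewrite -ltrBlDl; apply: le_lt_trans (ler_norm _) _; rewrite distrC.
    by near: y; apply: cvg_within; move/cvgrPdist_lt: cH; apply.
  - rewrite -ltrBlDl; apply: le_lt_trans (ler_norm _) _; rewrite distrC.
    by near: y; apply: cvg_within; move/cvgrPdist_lt: cV; apply.
move=> [y [xy yx fy Hy Vy]].
have volE : \int[mu]_(x in `]x0, y[) f x = V y - V x0.
  apply: (integral_itv_primitive cf dV); lra.
have bulkE : \int[mu]_(x in `]x0, y[) bulk x = H y - H x0.
  apply: (integral_itv_primitive cb dH); lra.
have v0 : 0 < V y - V x0.
  by have := volume_ge_length (ltW xy); rewrite volE; lra.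
have [r r0 [_ vr minr]] := minv _ v0.
have nrr : - r < r by rewrite gtrN.
have := minr `]x0, y[%classic (finite_perimeter_interval xy).
rewrite volume_interval volE => /(_ erefl).
rewrite !energy_interval// lee_fin densityN bulkE.
(* Length is bounded by volume, so [2 r < d] and the density at [r] is still close to [f 0]. *)
have := @volume_ge_length (- r) r (ltW nrr).
move: vr; rewrite /centered_interval volume_interval => -[->] rV.
have := fd r; rewrite -ball_normE/= sub0r normrN gtr0_norm// => /(_ _)/wrap[]; first lra.
rewrite ltr_norml => /andP[_ fr].
have : 0 <= \int[mu]_(x in `]- r, r[) bulk x.
  by apply: Rintegral_ge0 => x _; exact: bulk_ge0 adm x.
by move: fr; rewrite /eta in fy Hy eta0 *; lra.
Unshelve. all: by end_near. Qed.

End intervals.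

Lemma is_min_radial {R : realType} (psi : R -> R) :
  is_min [set psi r | r in [set r : R | 0 <= r]] (psi 0) <->
  forall x, 0 <= x -> psi 0 <= psi x.
Proof.
split=> [[_ lb] x x0|H]; first by apply: lb; exists x.
by split=> [|_ [x x0 <-]]; [exists 0; rewrite //= lexx|exact: H].
Qed.

Unset Implicit Arguments.

Theorem theorem1p2 (R : realType) (psi g : R -> R) (hadm : admissible psi g) :
  ((forall v : R, 0 < v ->
      exists2 r : R, 0 < r & is_minimizer psi g v (centered_interval r))
   <-> is_min [set psi r | r in [set r : R | 0 <= r]] (psi 0))
  /\
  (strictly_admissible psi g ->
   is_min [set psi r | r in [set r : R | 0 <= r]] (psi 0) ->
   forall v : R, 0 < v ->
     exists2 r : R, 0 < r &
       is_minimizer psi g v (centered_interval r) /\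
       forall F : set R, is_minimizer psi g v F ->
         completed_lebesgue_measure (F `+` centered_interval r) = 0%E).
Proof.
split; first split.
- by move=> /(centered_minimizers_min hadm) /is_min_radial.
- move=> /is_min_radial psi_min v v0; have [r r0 rv] := centered_volume hadm v0.
  by exists r => //; exact: centered_minimizer.
- move=> sadm /is_min_radial psi_min v v0; have [r r0 rv] := centered_volume hadm v0.
  exists r => //; split; first exact: centered_minimizer.
  by move=> F; exact: minimizer_unique.
Qed.
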